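(* Let $G$ be a group acting properly, cocompactly and freely on a finite-dimensional AR $X_1$ and on an AR $X_2$. Assume that $X_1$ and $X_2$ are $G$-equivariantly homotopy equivalent and that $(\hat{X}_2,Z)$, with $\hat{X}_2=X_2\cup Z$, is an AR $\mathscr{Z}$-structure on $G$. Then there is a compactification $\hat{X}_1=X_1\cup Z$ of $X_1$ with remainder $Z$ such that $(\hat{X}_1,Z)$ is a $\mathscr{Z}$-structure on $G$.
   Context: All spaces are locally compact, separable and metrizable. A separable metric space is an AR if whenever it is embedded as a closed subset of another separable metric space, its image is a retract of that space; it is an ANR if some neighborhood of the image retracts onto it; an ER is a finite-dimensional AR. A closed subset $A$ of an ANR $Y$ is a $\mathscr{Z}$-set if there is a homotopy $H:Y\times[0,1]\to Y$ with $H_0=\mathrm{id}_Y$ and $H_t(Y)\subset Y-A$ for all $t>0$; a $\mathscr{Z}$-compactification of $Y$ is a compactification $\hat{Y}$ with $\hat{Y}-Y$ a $\mathscr{Z}$-set in $\hat{Y}$. A $\mathscr{Z}$-structure on a group $G$ is a pair $(\hat{X},Z)$ such that: (1) $\hat{X}$ is a compact ER; (2) $\hat{X}$ is a $\mathscr{Z}$-compactification of $X=\hat{X}-Z$; (3) $G$ acts properly, cocompactly and freely on $X$; (4) (nullity condition) for every compact $C\subseteq X$ and every open cover $\mathscr{U}$ of $\hat{X}$, all but finitely many $G$-translates of $C$ lie in a single element of $\mathscr{U}$. An AR $\mathscr{Z}$-structure on $G$ is a pair satisfying the same conditions except that in (1) $\hat{X}$ is only required to be a compact AR. *)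

(* Defs.v *)
From Stdlib Require Import Reals List ProofIrrelevance.
Open Scope R_scope.

(* ---------- metric spaces (all spaces in the paper are metrizable) ---------- *)
Record MetricSpace := {
  mcar :> Type;
  dist : mcar -> mcar -> R;
  dist_refl : forall x, dist x x = 0;
  dist_eq : forall x y, dist x y = 0 -> x = y;
  dist_sym : forall x y, dist x y = dist y x;
  dist_tri : forall x y z, dist x z <= dist x y + dist y z
}.
Arguments dist {m} _ _.

Definition subspace (X : MetricSpace) (P : X -> Prop) : MetricSpace.
Proof.
  refine {| mcar := {x : X | P x};
            dist := fun x y => dist (proj1_sig x) (proj1_sig y) |}.
  - intros [x px]; apply dist_refl.
  - intros [x px] [y py] H; simpl in H. apply dist_eq in H. subst y.
    f_equal; apply proof_irrelevance.
  - intros x y; apply dist_sym.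
  - intros x y z; apply dist_tri.
Defined.

Definition compl {X : Type} (A : X -> Prop) : X -> Prop := fun x => ~ A x.

Definition continuous {X Y : MetricSpace} (f : X -> Y) : Prop :=
  forall x eps, 0 < eps -> exists delta, 0 < delta /\
    forall y, dist x y < delta -> dist (f x) (f y) < eps.

Definition is_open {X : MetricSpace} (U : X -> Prop) : Prop :=
  forall x, U x -> exists r, 0 < r /\ forall y, dist x y < r -> U y.

Definition is_closed {X : MetricSpace} (C : X -> Prop) : Prop := is_open (compl C).

Definition dense {X : MetricSpace} (D : X -> Prop) : Prop :=
  forall x r, 0 < r -> exists y, D y /\ dist x y < r.

Definition separable (X : MetricSpace) : Prop :=
  exists s : nat -> X, dense (fun y => exists n, s n = y).

Definition compact_set {X : MetricSpace} (K : X -> Prop) : Prop :=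
  forall (I : Type) (U : I -> X -> Prop),
    (forall i, is_open (U i)) -> (forall x, K x -> exists i, U i x) ->
    exists l : list I, forall x, K x -> exists i, In i l /\ U i x.

Definition compact_space (X : MetricSpace) : Prop := compact_set (fun _ : X => True).

Definition locally_compact (X : MetricSpace) : Prop :=
  forall x : X, exists (K : X -> Prop) r, compact_set K /\ 0 < r /\
    forall y, dist x y < r -> K y.

Definition homeomorphism {X Y : MetricSpace} (f : X -> Y) : Prop :=
  exists g : Y -> X, continuous f /\ continuous g /\
    (forall x, g (f x) = x) /\ (forall y, f (g y) = y).

Definition homeomorphic (X Y : MetricSpace) : Prop :=
  exists f : X -> Y, homeomorphism f.

Definition closed_embedding {X Y : MetricSpace} (j : X -> Y) : Prop :=
  continuous j /\ (forall x x', j x = j x' -> x = x') /\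
  (forall x eps, 0 < eps -> exists delta, 0 < delta /\
     forall x', dist (j x) (j x') < delta -> dist x x' < eps) /\
  is_closed (fun y => exists x, j x = y).

Definition AR (X : MetricSpace) : Prop :=
  separable X /\
  forall (Y : MetricSpace), separable Y -> forall j : X -> Y, closed_embedding j ->
    exists r : Y -> X, continuous r /\ forall x, r (j x) = x.

(* covering dimension <= n (finite open covers, refinements of order <= n+1) *)
Definition dim_le (X : MetricSpace) (n : nat) : Prop :=
  forall U : list (X -> Prop),
    (forall V, In V U -> is_open V) -> (forall x, exists V, In V U /\ V x) ->
    exists W : list (X -> Prop),
      (forall V, In V W -> is_open V) /\ (forall x, exists V, In V W /\ V x) /\
      (forall V, In V W -> exists U0, In U0 U /\ forall x, V x -> U0 x) /\
      (forall x (idx : list nat), NoDup idx -> length idx = (n + 2)%nat ->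
         (forall i, In i idx -> (i < length W)%nat) ->
         exists i, In i idx /\ ~ (nth i W (fun _ => False)) x).

Definition finite_dim (X : MetricSpace) : Prop := exists n, dim_le X n.

Definition ER (X : MetricSpace) : Prop := AR X /\ finite_dim X.

Definition htpy_continuous {X Y : MetricSpace} (H : X -> R -> Y) : Prop :=
  forall x t, 0 <= t <= 1 -> forall eps, 0 < eps -> exists delta, 0 < delta /\
    forall x' t', 0 <= t' <= 1 -> dist x x' < delta -> Rabs (t - t') < delta ->
      dist (H x t) (H x' t') < eps.

Definition Zset {Y : MetricSpace} (A : Y -> Prop) : Prop :=
  is_closed A /\
  exists H : Y -> R -> Y, htpy_continuous H /\ (forall y, H y 0 = y) /\
    (forall y t, 0 < t <= 1 -> ~ A (H y t)).

Record Group := {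
  gcar :> Type;
  gmul : gcar -> gcar -> gcar;
  gone : gcar;
  ginv : gcar -> gcar;
  gassoc : forall a b c, gmul a (gmul b c) = gmul (gmul a b) c;
  gone_l : forall a, gmul gone a = a;
  ginv_l : forall a, gmul (ginv a) a = gone
}.
Arguments gmul {g} _ _.
Arguments gone {g}.
Arguments ginv {g} _.

Definition is_action {G : Group} {X : MetricSpace} (a : G -> X -> X) : Prop :=
  (forall x, a gone x = x) /\ (forall g h x, a (gmul g h) x = a g (a h x)) /\
  (forall g, continuous (a g)).

Definition proper_action {G : Group} {X : MetricSpace} (a : G -> X -> X) : Prop :=
  forall K : X -> Prop, compact_set K ->
    exists l : list G, forall g, (exists x, K x /\ K (a g x)) -> In g l.

Definition cocompact_action {G : Group} {X : MetricSpace} (a : G -> X -> X) : Prop :=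
  exists K : X -> Prop, compact_set K /\ forall x, exists g y, K y /\ a g y = x.

Definition free_action {G : Group} {X : MetricSpace} (a : G -> X -> X) : Prop :=
  forall g x, a g x = x -> g = gone.

Definition nullity {G : Group} {Xh : MetricSpace} (Z : Xh -> Prop)
    (a : G -> subspace Xh (compl Z) -> subspace Xh (compl Z)) : Prop :=
  forall C : subspace Xh (compl Z) -> Prop, compact_set C ->
  forall (I : Type) (U : I -> Xh -> Prop),
    (forall i, is_open (U i)) -> (forall x, exists i, U i x) ->
    exists l : list G, forall g, ~ In g l ->
      exists i, forall x, C x -> U i (proj1_sig (a g x)).

Definition ZStructure_common {G : Group} (Xh : MetricSpace) (Z : Xh -> Prop)
    (a : G -> subspace Xh (compl Z) -> subspace Xh (compl Z)) : Prop :=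
  compact_space Xh /\ is_closed Z /\ dense (compl Z) /\ Zset Z /\
  is_action a /\ proper_action a /\ cocompact_action a /\ free_action a /\
  nullity Z a.

Definition ZStructure {G : Group} (Xh : MetricSpace) (Z : Xh -> Prop)
    (a : G -> subspace Xh (compl Z) -> subspace Xh (compl Z)) : Prop :=
  ER Xh /\ ZStructure_common Xh Z a.

Definition AR_ZStructure {G : Group} (Xh : MetricSpace) (Z : Xh -> Prop)
    (a : G -> subspace Xh (compl Z) -> subspace Xh (compl Z)) : Prop :=
  AR Xh /\ ZStructure_common Xh Z a.

Definition equivariant {G : Group} {X Y : MetricSpace}
    (a : G -> X -> X) (b : G -> Y -> Y) (f : X -> Y) : Prop :=
  forall g x, f (a g x) = b g (f x).

Definition equiv_homotopic {G : Group} {X Y : MetricSpace}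
    (a : G -> X -> X) (b : G -> Y -> Y) (f0 f1 : X -> Y) : Prop :=
  exists H : X -> R -> Y, htpy_continuous H /\
    (forall x, H x 0 = f0 x) /\ (forall x, H x 1 = f1 x) /\
    (forall t, 0 <= t <= 1 -> equivariant a b (fun x => H x t)).

Definition equiv_htpy_equivalent {G : Group} {X Y : MetricSpace}
    (a : G -> X -> X) (b : G -> Y -> Y) : Prop :=
  exists (f : X -> Y) (g : Y -> X),
    continuous f /\ continuous g /\ equivariant a b f /\ equivariant b a g /\
    equiv_homotopic a a (fun x => g (f x)) (fun x => x) /\
    equiv_homotopic b b (fun y => f (g y)) (fun y => y).

(* Main.v *)
From Stdlib Require Import Reals RList List Lra Lia Classical ClassicalEpsilon
  FunctionalExtensionality ProofIrrelevance Cantor.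
Require Import Defs.

(** Let [f : X1 -> X2] and [k : X2 -> X1] be the equivariant maps, [J] the homotopy from [k f]
    to the identity, and [h] the homotopy pushing [X2 ∪ Z] off [Z]. The space [X1 ∪ Z] carries
    the coarsest topology that keeps [X1] as an open subspace and makes [f], extended by the
    identity of [Z], continuous; it is compact because [f] is proper. By the nullity condition
    equivariant maps that agree up to a bounded amount agree in the limit at [Z], so [k] and [J]
    extend by the identity of [Z]. Points deep inside [X1] retreat along [J] for a while, points
    near [Z] soon follow [k h_t f]: this pushes [X1 ∪ Z] off [Z] instantly. Pulling covers of
    [X1] back along a small push bounds the dimension of [X1 ∪ Z]. For a closed embedding of
    [X1 ∪ Z] in [Y], the push, seen as a map to the absolute extensor [X1] defined on
    [(X1 ∪ Z) × (0, 1]], extends to [Y × (0, 1]]; restricting the extension to the graph of a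
    function that tends to [0] slowly enough at [X1 ∪ Z] gives a retraction. *)

(** * Neighbourhoods and continuity *)

Lemma dist_nonneg {X : MetricSpace} (x y : X) : 0 <= dist x y.
Proof.
  pose proof (dist_tri X x y x) as Htri. rewrite dist_refl, (dist_sym X y x) in Htri. lra.
Qed.

Lemma eq_of_dist_le_0 {X : MetricSpace} (x y : X) : dist x y <= 0 -> x = y.
Proof. intros Hle. apply dist_eq, Rle_antisym; [exact Hle | apply dist_nonneg]. Qed.

Definition range {X Y : Type} (f : X -> Y) (y : Y) : Prop := exists x, f x = y.

Definition image {X Y : Type} (f : X -> Y) (K : X -> Prop) (y : Y) : Prop :=
  exists x, K x /\ f x = y.

Lemma range_intro {X Y : Type} (f : X -> Y) (x : X) : range f (f x).
Proof. now exists x. Qed.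

Lemma image_intro {X Y : Type} (f : X -> Y) (K : X -> Prop) (x : X) : K x -> image f K (f x).
Proof. now exists x. Qed.

Definition near {X : MetricSpace} (x : X) (P : X -> Prop) : Prop :=
  exists d, 0 < d /\ forall y, dist x y < d -> P y.

Lemma near_self {X : MetricSpace} {x : X} {P : X -> Prop} : near x P -> P x.
Proof. intros (d & Hd & HP). apply HP. now rewrite dist_refl. Qed.

Lemma near_mono {X : MetricSpace} {x : X} {P Q : X -> Prop} :
  near x P -> (forall y, P y -> Q y) -> near x Q.
Proof. intros (d & Hd & HP) HPQ. exists d. auto. Qed.

Lemma near_and {X : MetricSpace} {x : X} {P Q : X -> Prop} :
  near x P -> near x Q -> near x (fun y => P y /\ Q y).
Proof.
  intros (d & Hd & HP) (d' & Hd' & HQ). exists (Rmin d d'). split; [now apply Rmin_pos|].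
  intros y Hy. pose proof (Rmin_l d d'). pose proof (Rmin_r d d').
  split; [apply HP | apply HQ]; lra.
Qed.

Lemma near_ball {X : MetricSpace} (x : X) (r : R) : 0 < r -> near x (fun y => dist x y < r).
Proof. intros Hr. exists r. auto. Qed.

Lemma is_open_near {X : MetricSpace} (P : X -> Prop) : is_open (fun x => near x P).
Proof.
  intros x (d & Hd & HP). exists (d / 2). split; [lra|].
  intros y Hy. exists (d / 2). split; [lra|].
  intros z Hz. apply HP. pose proof (dist_tri X x y z). lra.
Qed.

Lemma is_open_ball {X : MetricSpace} (x : X) (r : R) : is_open (fun y => dist x y < r).
Proof.
  intros y Hy. exists (r - dist x y). split; [lra|].
  intros z Hz. pose proof (dist_tri X x y z). lra.
Qed.

Lemma is_closed_iff {X : MetricSpace} (A B : X -> Prop) :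
  (forall x, A x <-> B x) -> is_closed A -> is_closed B.
Proof.
  intros HAB HA x Hx. apply (near_mono (HA x (fun h => Hx (proj1 (HAB x) h)))).
  intros y Hy Hb. now apply Hy, HAB.
Qed.

Lemma is_closed_and {X : MetricSpace} (A B : X -> Prop) :
  is_closed A -> is_closed B -> is_closed (fun x => A x /\ B x).
Proof.
  intros HA HB x Hx. destruct (not_and_or _ _ Hx) as [HAx | HBx].
  - apply (near_mono (HA x HAx)). intros y HAy HABy. now apply HAy.
  - apply (near_mono (HB x HBx)). intros y HBy HABy. now apply HBy.
Qed.

Lemma id_continuous (X : MetricSpace) : continuous (fun x : X => x).
Proof. intros x eps Heps. exists eps. auto. Qed.

Lemma constant_continuous {X Y : MetricSpace} (c : Y) : continuous (fun _ : X => c).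
Proof. intros x eps Heps. exists 1. split; [lra|]. intros y _. now rewrite dist_refl. Qed.

Definition continuous_on {X Y : MetricSpace} (D : X -> Prop) (f : X -> Y) : Prop :=
  forall x, D x -> forall eps, 0 < eps -> near x (fun y => D y -> dist (f x) (f y) < eps).

Lemma continuous_on_near {X Y : MetricSpace} {D : X -> Prop} {f : X -> Y} {x : X}
    {P : Y -> Prop} :
  continuous_on D f -> D x -> near (f x) P -> near x (fun y => D y -> P (f y)).
Proof. intros Hf Hx (d & Hd & HP). apply (near_mono (Hf x Hx d Hd)). auto. Qed.

Lemma continuous_near {X Y : MetricSpace} {f : X -> Y} {x : X} {P : Y -> Prop} :
  continuous f -> near (f x) P -> near x (fun y => P (f y)).
Proof. intros Hf (d & Hd & HP). apply (near_mono (Hf x d Hd)). auto. Qed.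

Lemma continuous_near_ball {X Y : MetricSpace} {f : X -> Y} (x : X) {eps : R} :
  continuous f -> 0 < eps -> near x (fun y => dist (f x) (f y) < eps).
Proof. intros Hf. apply Hf. Qed.

Lemma continuous_on_open_near_ball {X Y : MetricSpace} {U : X -> Prop} {f : X -> Y} {x : X}
    {eps : R} :
  is_open U -> continuous_on U f -> U x -> 0 < eps -> near x (fun y => dist (f x) (f y) < eps).
Proof.
  intros HU Hf Hx Heps. apply (near_mono (near_and (HU x Hx) (Hf x Hx eps Heps))).
  intros y [Hy Hclose]. auto.
Qed.

Lemma continuous_continuous_on {X Y : MetricSpace} (D : X -> Prop) (f : X -> Y) :
  continuous f -> continuous_on D f.
Proof. intros Hf x _ eps Heps. apply (near_mono (Hf x eps Heps)). auto. Qed.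

Lemma continuous_iff_on {X Y : MetricSpace} (f : X -> Y) :
  continuous f <-> continuous_on (fun _ => True) f.
Proof.
  split; [apply continuous_continuous_on|].
  intros Hf x eps Heps. apply (near_mono (Hf x I eps Heps)). auto.
Qed.

Lemma continuous_on_of_subspace {X Y : MetricSpace} (D : X -> Prop) (f : X -> Y) :
  continuous (fun x : subspace X D => f (proj1_sig x)) -> continuous_on D f.
Proof.
  intros Hf x Hx eps Heps. destruct (Hf (exist _ x Hx) eps Heps) as (d & Hd & Hclose).
  exists d. split; [exact Hd|]. intros y Hxy Hy. exact (Hclose (exist _ y Hy) Hxy).
Qed.

Lemma continuous_on_extend_subspace {X Y : MetricSpace} (D : X -> Prop) (F : subspace X D -> Y) :
  Y -> continuous F -> exists f : X -> Y, continuous_on D f /\ forall p, f (proj1_sig p) = F p.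
Proof.
  intros y0 HF.
  set (f := fun x => match excluded_middle_informative (D x) with
    | left h => F (exist _ x h) | right _ => y0 end).
  assert (Hf : forall p, f (proj1_sig p) = F p).
  { intros [x h]. unfold f. simpl. destruct (excluded_middle_informative (D x)) as [h'|];
      [|contradiction]. now rewrite (proof_irrelevance _ h' h). }
  exists f. split; [|exact Hf]. apply continuous_on_of_subspace. intros p eps Heps.
  apply (near_mono (continuous_near_ball p HF Heps)).
  intros q Hq. now rewrite !Hf.
Qed.

Lemma continuous_on_comp {X Y W : MetricSpace} {D : X -> Prop} {E : Y -> Prop}
    {f : X -> Y} {g : Y -> W} :
  continuous_on D f -> continuous_on E g -> (forall x, D x -> E (f x)) ->
  continuous_on D (fun x => g (f x)).
Proof.
  intros Hf Hg HDE x Hx eps Heps.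
  apply (near_mono (continuous_on_near Hf Hx (Hg (f x) (HDE x Hx) eps Heps))). auto.
Qed.

Lemma continuous_comp {X Y W : MetricSpace} {f : X -> Y} {g : Y -> W} :
  continuous f -> continuous g -> continuous (fun x => g (f x)).
Proof. intros Hf Hg x eps Heps. exact (continuous_near Hf (Hg (f x) eps Heps)). Qed.

Lemma continuous_on_preimage {X Y W : MetricSpace} {E : Y -> Prop} {f : X -> Y} {g : Y -> W} :
  continuous f -> continuous_on E g -> continuous_on (fun x => E (f x)) (fun x => g (f x)).
Proof.
  intros Hf Hg. apply (continuous_on_comp (continuous_continuous_on _ f Hf) Hg). auto.
Qed.

Lemma continuous_on_subset {X Y : MetricSpace} {D E : X -> Prop} {f : X -> Y} :
  continuous_on D f -> (forall x, E x -> D x) -> continuous_on E f.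
Proof. intros Hf HED x Hx eps Heps. apply (near_mono (Hf x (HED x Hx) eps Heps)). auto. Qed.

Lemma continuous_on_eq {X Y : MetricSpace} {D : X -> Prop} {f g : X -> Y} :
  (forall x, D x -> f x = g x) -> continuous_on D f -> continuous_on D g.
Proof.
  intros Hfg Hf x Hx eps Heps. apply (near_mono (Hf x Hx eps Heps)).
  intros y Hy HDy. rewrite <- !Hfg; auto.
Qed.

Lemma continuous_on_union_closed {X Y : MetricSpace} {A B : X -> Prop} {f : X -> Y} :
  is_closed A -> is_closed B -> continuous_on A f -> continuous_on B f ->
  continuous_on (fun x => A x \/ B x) f.
Proof.
  assert (Hpiece : forall C, is_closed C -> continuous_on C f -> forall x eps, 0 < eps ->
      near x (fun y => C y -> dist (f x) (f y) < eps)).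
  { intros C HC Hf x eps Heps. destruct (classic (C x)) as [Hx | Hx]; [now apply Hf|].
    apply (near_mono (HC x Hx)). intros y Hy HCy. contradiction. }
  intros HA HB HfA HfB x _ eps Heps.
  apply (near_mono (near_and (Hpiece A HA HfA x eps Heps) (Hpiece B HB HfB x eps Heps))).
  tauto.
Qed.

Lemma lipschitz_continuous {X Y : MetricSpace} (L : R) (f : X -> Y) :
  0 < L -> (forall x y, dist (f x) (f y) <= L * dist x y) -> continuous f.
Proof.
  intros HL Hlip x eps Heps. exists (eps / L). split; [now apply Rdiv_lt_0_compat|].
  intros y Hy. eapply Rle_lt_trans; [apply Hlip|].
  replace eps with (L * (eps / L)) by (field; lra). now apply Rmult_lt_compat_l.
Qed.

Lemma is_open_preimage {X Y : MetricSpace} (f : X -> Y) (U : Y -> Prop) :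
  continuous f -> is_open U -> is_open (fun x => U (f x)).
Proof. intros Hf HU x Hx. exact (continuous_near Hf (HU (f x) Hx)). Qed.

Lemma closed_embedding_of_inverse_modulus {X Y : MetricSpace} (j : X -> Y) :
  continuous j -> is_closed (range j) ->
  (forall x eps, 0 < eps -> exists d, 0 < d /\
     forall x', dist (j x) (j x') < d -> dist x x' < eps) ->
  closed_embedding j.
Proof.
  intros Hj Hcl Hinv. split; [exact Hj|]. split; [|split; [exact Hinv | exact Hcl]].
  intros x x' Heq. apply eq_of_dist_le_0. apply Rnot_lt_le. intros Hpos.
  destruct (Hinv x _ Hpos) as (d & Hd & Hclose).
  apply (Rlt_irrefl (dist x x')), Hclose. now rewrite Heq, dist_refl.
Qed.

Lemma closed_embedding_left_inverse {X Y : MetricSpace} (j : X -> Y) :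
  X -> closed_embedding j ->
  exists g : Y -> X, continuous_on (range j) g /\ forall x, g (j x) = x.
Proof.
  intros x0 (_ & j_injective & j_inverse & _).
  set (g := fun y => epsilon (inhabits x0) (fun x => j x = y)).
  assert (Hgj : forall x, g (j x) = x).
  { intros x. apply j_injective. apply (epsilon_spec (inhabits x0) (fun x' => j x' = j x)). eauto. }
  exists g. split; [|exact Hgj]. intros _ [x <-] eps Heps.
  destruct (j_inverse x eps Heps) as (d & Hd & Hclose). exists d. split; [exact Hd|].
  intros _ Hdist [x' <-]. rewrite !Hgj. now apply Hclose.
Qed.

(** * Constructions of metric spaces *)

Lemma subspace_eq {X : MetricSpace} {P : X -> Prop} (p q : subspace X P) :
  proj1_sig p = proj1_sig q -> p = q.
Proof.
  destruct p as [x hx], q as [y hy]; simpl. intros ->. f_equal. apply proof_irrelevance.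
Qed.

Lemma proj1_sig_continuous {X : MetricSpace} (P : X -> Prop) :
  continuous (fun p : subspace X P => proj1_sig p).
Proof. intros p eps Heps. exists eps. auto. Qed.

Definition pullback {X : MetricSpace} {T : Type} (c : T -> X)
  (c_injective : forall s t, c s = c t -> s = t) : MetricSpace.
Proof.
  refine {| mcar := T; dist := fun s t => dist (c s) (c t) |}.
  - intros s. apply dist_refl.
  - intros s t Hst. apply c_injective. now apply dist_eq.
  - intros s t. apply dist_sym.
  - intros s t u. apply dist_tri.
Defined.

Definition R_line : MetricSpace.
Proof.
  refine {| mcar := R; dist := fun s t => Rabs (s - t) |}.
  - intros s. now rewrite Rminus_diag, Rabs_R0.
  - intros s t Hst. apply Rminus_diag_uniq. apply NNPP. intros Hne.
    now apply (Rabs_no_R0 (s - t)).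
  - intros s t. apply Rabs_minus_sym.
  - intros s t u. replace (s - u) with ((s - t) + (t - u)) by ring. apply Rabs_triang.
Defined.

Definition prod_space (X Y : MetricSpace) : MetricSpace.
Proof.
  refine {| mcar := (X * Y)%type;
            dist := fun p q => dist (fst p) (fst q) + dist (snd p) (snd q) |}.
  - intros p. rewrite !dist_refl. lra.
  - intros [x y] [x' y'] Heq; simpl in Heq.
    pose proof (dist_nonneg x x'). pose proof (dist_nonneg y y').
    f_equal; apply eq_of_dist_le_0; lra.
  - intros p q. now rewrite (dist_sym X), (dist_sym Y).
  - intros p q r. pose proof (dist_tri X (fst p) (fst q) (fst r)).
    pose proof (dist_tri Y (snd p) (snd q) (snd r)). lra.
Defined.

Lemma fst_continuous (X Y : MetricSpace) : continuous (fun p : prod_space X Y => fst p).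
Proof.
  apply (lipschitz_continuous 1 (fun p : prod_space X Y => fst p)); [lra|].
  intros p q. simpl. pose proof (dist_nonneg (snd p) (snd q)). lra.
Qed.

Lemma snd_continuous (X Y : MetricSpace) : continuous (fun p : prod_space X Y => snd p).
Proof.
  apply (lipschitz_continuous 1 (fun p : prod_space X Y => snd p)); [lra|].
  intros p q. simpl. pose proof (dist_nonneg (fst p) (fst q)). lra.
Qed.

Lemma continuous_on_pair {W X Y : MetricSpace} {D : W -> Prop} {f : W -> X} {g : W -> Y} :
  continuous_on D f -> continuous_on D g ->
  continuous_on D (fun w => (f w, g w) : prod_space X Y).
Proof.
  intros Hf Hg w Hw eps Heps.
  apply (near_mono (near_and (Hf w Hw (eps / 2) ltac:(lra)) (Hg w Hw (eps / 2) ltac:(lra)))).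
  intros w' [Hf' Hg'] Hw'. simpl. specialize (Hf' Hw'). specialize (Hg' Hw'). lra.
Qed.

Lemma continuous_pair {W X Y : MetricSpace} {f : W -> X} {g : W -> Y} :
  continuous f -> continuous g -> continuous (fun w => (f w, g w) : prod_space X Y).
Proof. rewrite !continuous_iff_on. apply continuous_on_pair. Qed.

Lemma is_closed_le {X : MetricSpace} (f g : X -> R_line) :
  continuous f -> continuous g -> is_closed (fun x => f x <= g x).
Proof.
  intros Hf Hg x Hx. apply Rnot_le_lt in Hx.
  apply (near_mono (near_and (Hf x ((f x - g x) / 2) ltac:(lra))
    (Hg x ((f x - g x) / 2) ltac:(lra)))).
  intros y [Hfy Hgy]. simpl in Hfy, Hgy. apply Rabs_def2 in Hfy, Hgy. unfold compl. lra.
Qed.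

Lemma continuous_minus {X : MetricSpace} (f g : X -> R_line) :
  continuous f -> continuous g -> continuous ((fun x => f x - g x) : X -> R_line).
Proof.
  intros Hf Hg x eps Heps.
  apply (near_mono (near_and (Hf x (eps / 2) ltac:(lra)) (Hg x (eps / 2) ltac:(lra)))).
  intros y [Hfy Hgy]. simpl in *. apply Rabs_def2 in Hfy, Hgy. apply Rabs_def1; lra.
Qed.

Lemma Rdiv_le_of_le_mul (r s q : R) : 0 < s -> r <= q * s -> r / s <= q.
Proof.
  intros Hs Hr. apply Rmult_le_reg_r with s; [exact Hs|].
  replace (r / s * s) with r by (field; lra). exact Hr.
Qed.

Lemma Rle_div_of_mul_le (r s q : R) : 0 < s -> q * s <= r -> q <= r / s.
Proof.
  intros Hs Hr. apply Rmult_le_reg_r with s; [exact Hs|].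
  replace (r / s * s) with r by (field; lra). exact Hr.
Qed.

Lemma Rdiv_continuous_on :
  continuous_on (X := prod_space R_line R_line) (Y := R_line)
    (fun q => snd q <> 0) (fun q => fst q / snd q).
Proof.
  intros [t w] Hw eps Heps. simpl in Hw. pose proof (Rabs_pos_lt w Hw) as Hpos.
  set (M := Rabs (t / w) + 1). pose proof (Rabs_pos (t / w)).
  assert (HM : 1 <= M) by (unfold M; lra).
  assert (Hradius : 0 < eps * Rabs w / (2 * M)) by (apply Rdiv_lt_0_compat; nra).
  apply (near_mono (near_and
    (near_ball ((t, w) : prod_space R_line R_line) (Rabs w / 2) ltac:(lra))
    (near_ball ((t, w) : prod_space R_line R_line) _ Hradius))).
  intros [t' w'] [Hhalf Hsmall] Hw'. simpl in *.
  pose proof (Rabs_pos (t - t')). pose proof (Rabs_pos (w - w')).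
  pose proof (Rabs_triang_inv w w'). pose proof (Rabs_pos_lt w' Hw').
  replace (t / w - t' / w') with ((t - t' - t / w * (w - w')) * / w') by (field; auto).
  assert (Hnum : Rabs (t - t' - t / w * (w - w')) <= M * (Rabs (t - t') + Rabs (w - w'))).
  { apply Rle_trans with (1 := Rabs_triang _ _). rewrite Rabs_Ropp, Rabs_mult. unfold M. nra. }
  assert (HMsmall : M * (Rabs (t - t') + Rabs (w - w')) < eps * Rabs w / 2).
  { replace (eps * Rabs w / 2) with (M * (eps * Rabs w / (2 * M))) by (field; lra).
    apply Rmult_lt_compat_l; lra. }
  rewrite Rabs_mult, Rabs_inv. apply Rmult_lt_reg_r with (Rabs w'); [lra|].
  rewrite Rmult_assoc, Rinv_l by lra. nra.
Qed.

Lemma htpy_continuous_iff {X Y : MetricSpace} (H : X -> R -> Y) :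
  htpy_continuous H <->
  continuous_on (fun p : prod_space X R_line => 0 <= snd p <= 1) (fun p => H (fst p) (snd p)).
Proof.
  split.
  - intros HH [x t] Ht eps Heps. destruct (HH x t Ht eps Heps) as (d & Hd & Hclose).
    exists d. split; [exact Hd|]. intros [x' t'] Hdist Ht'. simpl in *.
    pose proof (dist_nonneg x x'). pose proof (Rabs_pos (t - t')). apply Hclose; lra.
  - intros HH x t Ht eps Heps. destruct (HH (x, t) Ht eps Heps) as (d & Hd & Hclose).
    exists (d / 2). split; [lra|]. intros x' t' Ht' Hx Htt.
    apply (Hclose (x', t')); simpl; lra.
Qed.

(** * Truncated suprema and distances to sets *)

Lemma sup01_exists (E : R -> Prop) : {m | is_lub (fun x => x = 0 \/ (E x /\ x <= 1)) m}.
Proof.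
  apply completeness.
  - exists 1. intros x [-> | [_ Hx]]; lra.
  - exists 0. now left.
Qed.

(* The supremum of [{0}] and the elements of [E] that are at most [1]: it is always defined. *)
Definition sup01 (E : R -> Prop) : R := proj1_sig (sup01_exists E).

Lemma sup01_ge (E : R -> Prop) (x : R) : E x -> x <= 1 -> x <= sup01 E.
Proof. intros Hx Hx1. apply (proj2_sig (sup01_exists E)). now right. Qed.

Lemma sup01_le (E : R -> Prop) (b : R) :
  0 <= b -> (forall x, E x -> x <= 1 -> x <= b) -> sup01 E <= b.
Proof.
  intros Hb Hbound. apply (proj2_sig (sup01_exists E)). intros x [-> | [Hx Hx1]]; auto.
Qed.

Lemma sup01_bounds (E : R -> Prop) : 0 <= sup01 E <= 1.
Proof.
  split; [apply (proj2_sig (sup01_exists E)); now left | apply sup01_le; [lra | auto]].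
Qed.

Lemma sup01_lt (E : R -> Prop) (x : R) :
  0 <= x -> x < sup01 E -> exists r, E r /\ r <= 1 /\ x < r.
Proof.
  intros Hx0 Hx. apply NNPP. intros Hnone. apply (Rlt_not_le _ _ Hx), sup01_le; [exact Hx0|].
  intros r Hr Hr1. apply Rnot_lt_le. intros Hlt. apply Hnone. eauto.
Qed.

(* This is [min 1 (inf_{z in A} d(x, z))]; in particular it equals [1] when [A] is empty. *)
Definition dist_to {X : MetricSpace} (A : X -> Prop) (x : X) : R :=
  sup01 (fun r => forall z, A z -> r <= dist x z).

Lemma dist_to_bounds {X : MetricSpace} (A : X -> Prop) (x : X) : 0 <= dist_to A x <= 1.
Proof. apply sup01_bounds. Qed.

Lemma dist_to_le {X : MetricSpace} (A : X -> Prop) (x z : X) : A z -> dist_to A x <= dist x z.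
Proof. intros Hz. apply sup01_le; [apply dist_nonneg | auto]. Qed.

Lemma dist_to_in {X : MetricSpace} (A : X -> Prop) (x : X) : A x -> dist_to A x = 0.
Proof.
  intros Hx. pose proof (dist_to_le A x x Hx) as Hle. rewrite dist_refl in Hle.
  pose proof (dist_to_bounds A x). lra.
Qed.

Lemma dist_to_le_add {X : MetricSpace} (A : X -> Prop) (x y : X) :
  dist_to A x <= dist_to A y + dist x y.
Proof.
  pose proof (dist_nonneg x y). pose proof (dist_to_bounds A y).
  apply sup01_le; [lra|]. intros r Hr Hr1.
  assert (r - dist x y <= dist_to A y); [|lra].
  apply sup01_ge; [|lra]. intros z Hz. specialize (Hr z Hz).
  pose proof (dist_tri X x y z). lra.
Qed.

Lemma dist_to_lipschitz {X : MetricSpace} (A : X -> Prop) (x y : X) :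
  Rabs (dist_to A x - dist_to A y) <= dist x y.
Proof.
  pose proof (dist_to_le_add A x y). pose proof (dist_to_le_add A y x).
  rewrite (dist_sym X y x) in *. apply Rabs_le. lra.
Qed.

Lemma dist_to_continuous {X : MetricSpace} (A : X -> Prop) :
  continuous (dist_to A : X -> R_line).
Proof.
  apply (lipschitz_continuous 1); [lra|]. intros x y. rewrite Rmult_1_l.
  apply dist_to_lipschitz.
Qed.

Lemma dist_to_pos {X : MetricSpace} (A : X -> Prop) (x : X) :
  is_closed A -> ~ A x -> 0 < dist_to A x.
Proof.
  intros HA Hx. destruct (HA x Hx) as (r & Hr & Hball).
  apply Rlt_le_trans with (Rmin r 1); [apply Rmin_pos; lra|].
  apply sup01_ge; [|apply Rmin_r]. intros z Hz. apply Rnot_lt_le. intros Hlt.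
  apply (Hball z); auto. pose proof (Rmin_l r 1). lra.
Qed.

Lemma dist_to_approx {X : MetricSpace} (A : X -> Prop) (x : X) (r : R) :
  dist_to A x < r <= 1 -> exists z, A z /\ dist x z < r.
Proof.
  intros Hr. apply NNPP. intros Hnone. apply (Rlt_not_le r (dist_to A x)); [lra|].
  apply sup01_ge; [|lra]. intros z Hz. apply Rnot_lt_le. intros Hlt. apply Hnone. eauto.
Qed.

Lemma eq_of_dist_to_eq_0 {X : MetricSpace} (x y : X) : dist_to (eq y) x = 0 -> x = y.
Proof.
  intros Hzero. apply eq_of_dist_le_0, Rnot_lt_le. intros Hpos.
  destruct (dist_to_approx (eq y) x (Rmin 1 (dist x y))) as (_ & <- & Hlt).
  - rewrite Hzero. split; [apply Rmin_pos; lra | apply Rmin_l].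
  - pose proof (Rmin_r 1 (dist x y)). lra.
Qed.

(** * Compactness *)

Lemma compact_uniform {X : MetricSpace} (K : X -> Prop) (P : X -> R -> Prop) :
  compact_set K ->
  (forall x r r', 0 < r' <= r -> P x r -> P x r') ->
  (forall x, K x -> exists r, 0 < r /\ near x (fun y => P y r)) ->
  exists r, 0 < r /\ forall x, K x -> P x r.
Proof.
  intros HK Hmono Hloc.
  destruct (HK {r | 0 < r} (fun r x => near x (fun y => P y (proj1_sig r)))) as [l Hl].
  - intros r. apply is_open_near.
  - intros x Hx. destruct (Hloc x Hx) as (r & Hr & Hnear). now exists (exist _ r Hr).
  - assert (Hpos : 0 < MinRlist (map (@proj1_sig _ _) l)).
    { apply MinRlist_P2. intros s Hs. apply in_map_iff in Hs as ([r Hr] & <- & _). exact Hr. }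
    exists (MinRlist (map (@proj1_sig _ _) l)). split; [exact Hpos|]. intros x Hx.
    destruct (Hl x Hx) as (r & Hr & Hnear). apply (Hmono x (proj1_sig r)).
    + split; [exact Hpos | now apply MinRlist_P1, in_map].
    + exact (near_self Hnear).
Qed.

Lemma lebesgue_number {X : MetricSpace} {I : Type} (K : X -> Prop) (U : I -> X -> Prop) :
  compact_set K -> (forall x, K x -> exists i, near x (U i)) ->
  exists r, 0 < r /\ forall x, K x -> exists i, forall y, dist x y < r -> U i y.
Proof.
  intros HK Hcov.
  apply (compact_uniform K (fun x r => exists i, forall y, dist x y < r -> U i y) HK).
  - intros x r r' Hr [i Hi]. exists i. intros y Hy. apply Hi. lra.
  - intros x Hx. destruct (Hcov x Hx) as [i (r & Hr & Hball)].
    exists (r / 2). split; [lra|]. exists (r / 2). split; [lra|].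
    intros y Hy. exists i. intros z Hz. apply Hball. pose proof (dist_tri X x y z). lra.
Qed.

Lemma compact_thickening {X : MetricSpace} {K P : X -> Prop} :
  compact_set K -> (forall x, K x -> near x P) ->
  exists r, 0 < r /\ forall x y, K x -> dist x y < r -> P y.
Proof.
  intros HK Hnear. destruct (lebesgue_number K (fun _ : unit => P) HK) as (r & Hr & Hball).
  - intros x Hx. exists tt. auto.
  - exists r. split; [exact Hr|]. intros x y Hx Hy. destruct (Hball x Hx). auto.
Qed.

Lemma compact_closed_subset {X : MetricSpace} (K C : X -> Prop) :
  compact_set K -> is_closed C -> (forall x, C x -> K x) -> compact_set C.
Proof.
  intros HK HC Hsub I U HU Hcov.
  destruct (HK (option I)
    (fun o x => match o with Some i => U i x | None => ~ C x end)) as [l Hl].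
  - intros [i|]; [apply HU | apply HC].
  - intros x Hx. destruct (classic (C x)) as [HCx | HCx].
    + destruct (Hcov x HCx) as [i Hi]. now exists (Some i).
    + now exists None.
  - exists (flat_map (fun o => match o with Some i => i :: nil | None => nil end) l).
    intros x Hx. destruct (Hl x (Hsub x Hx)) as [[i|] [Hi Hu]]; [|contradiction].
    exists i. split; auto. apply in_flat_map. exists (Some i). simpl; auto.
Qed.

Lemma compact_is_closed {X : MetricSpace} (K : X -> Prop) : compact_set K -> is_closed K.
Proof.
  intros HK x Hx.
  destruct (compact_uniform K (fun y r => r <= dist x y) HK) as (r & Hr & Hfar).
  - intros; lra.
  - intros y Hy.
    assert (Hpos : 0 < dist x y).
    { apply Rnot_le_lt. intros Hle. apply Hx. now rewrite (eq_of_dist_le_0 x y Hle). }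
    exists (dist x y / 2). split; [lra|].
    apply (near_mono (near_ball y (dist x y / 2) ltac:(lra))). intros z Hz.
    pose proof (dist_tri X x z y). rewrite (dist_sym X z y) in *. lra.
  - exists r. split; [exact Hr|]. intros y Hy HKy. specialize (Hfar y HKy). lra.
Qed.

Lemma compact_union {X : MetricSpace} (K L : X -> Prop) :
  compact_set K -> compact_set L -> compact_set (fun x => K x \/ L x).
Proof.
  intros HK HL I U HU Hcov.
  destruct (HK I U HU) as [lK HlK]; [auto|]. destruct (HL I U HU) as [lL HlL]; [auto|].
  exists (lK ++ lL). intros x [Hx | Hx].
  - destruct (HlK x Hx) as [i [Hi Hu]]. exists i. split; auto. apply in_or_app; auto.
  - destruct (HlL x Hx) as [i [Hi Hu]]. exists i. split; auto. apply in_or_app; auto.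
Qed.

Lemma compact_list_union {X : MetricSpace} {J : Type} (K : J -> X -> Prop) (l : list J) :
  (forall j, compact_set (K j)) -> compact_set (fun x => exists j, In j l /\ K j x).
Proof.
  intros HK. induction l as [|j l IH]; intros I U HU Hcov.
  - exists nil. intros x [j [[] _]].
  - destruct (compact_union _ _ (HK j) IH I U HU) as [m Hm].
    + intros x [Hx | [k [Hk Hx]]]; apply Hcov.
      * exists j; simpl; auto.
      * exists k; simpl; auto.
    + exists m. intros x [k [[<- | Hk] Hx]]; apply Hm; eauto.
Qed.

Lemma compact_image {X Y : MetricSpace} (f : X -> Y) (K : X -> Prop) :
  continuous_on K f -> compact_set K -> compact_set (image f K).
Proof.
  intros Hf HK I U HU Hcov.
  destruct (HK I (fun i x => near x (fun y => K y -> U i (f y)))) as [l Hl].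
  - intros i. apply is_open_near.
  - intros x Hx. destruct (Hcov (f x) (image_intro f K x Hx)) as [i Hi].
    exists i. exact (continuous_on_near Hf Hx (HU i (f x) Hi)).
  - exists l. intros y (x & Hx & <-). destruct (Hl x Hx) as (i & Hi & Hnear).
    exists i. split; [exact Hi | exact (near_self Hnear Hx)].
Qed.

Lemma compact_subspace {X : MetricSpace} (P K : X -> Prop) :
  compact_set K -> (forall x, K x -> P x) ->
  compact_set (fun x : subspace X P => K (proj1_sig x)).
Proof.
  intros HK Hsub I U HU Hcov.
  destruct (HK I (fun i x => near x (fun y => forall h : P y, U i (exist _ y h)))) as [l Hl].
  - intros i. apply is_open_near.
  - intros x Hx. destruct (Hcov (exist _ x (Hsub x Hx)) Hx) as [i Hi]. exists i.
    destruct (HU i _ Hi) as (r & Hr & Hball). exists r. split; [exact Hr|].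
    intros y Hy h. now apply Hball.
  - exists l. intros [x h] Hx. destruct (Hl x Hx) as (i & Hi & Hnear).
    exists i. split; [exact Hi | exact (near_self Hnear h)].
Qed.

Lemma compact_tube {X Y : MetricSpace} {I : Type} (L : Y -> Prop)
    (U : I -> prod_space X Y -> Prop) (x : X) :
  compact_set L -> (forall i, is_open (U i)) -> (forall y, L y -> exists i, U i (x, y)) ->
  exists l, near x (fun x' => forall y, L y -> exists i, In i l /\ U i (x', y)).
Proof.
  intros HL HU Hcov.
  destruct (HL (I * {r | 0 < r})%type (fun q y => near y (fun y' =>
      forall x', dist x x' < proj1_sig (snd q) -> U (fst q) (x', y')))) as [l Hl].
  - intros q. apply is_open_near.
  - intros y Hy. destruct (Hcov y Hy) as [i Hi]. destruct (HU i _ Hi) as (r & Hr & Hball).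
    exists (i, exist (fun r => 0 < r) (r / 2) ltac:(lra)).
    apply (near_mono (near_ball y (r / 2) ltac:(lra))).
    intros y' Hy' x' Hx'. apply Hball. simpl in *. lra.
  - set (radii := map (fun q => proj1_sig (snd q)) l). exists (map fst l), (MinRlist radii). split.
    + apply MinRlist_P2. intros s Hs. apply in_map_iff in Hs as ([i [r Hr]] & <- & _). exact Hr.
    + intros x' Hx' y Hy. destruct (Hl y Hy) as (q & Hq & Hnear).
      exists (fst q). split; [now apply in_map|]. apply (near_self Hnear).
      apply Rlt_le_trans with (1 := Hx'), MinRlist_P1.
      exact (in_map (fun q => proj1_sig (snd q)) l q Hq).
Qed.

Lemma compact_prod {X Y : MetricSpace} (K : X -> Prop) (L : Y -> Prop) :
  compact_set K -> compact_set L ->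
  compact_set (fun p : prod_space X Y => K (fst p) /\ L (snd p)).
Proof.
  intros HK HL I U HU Hcov.
  destruct (HK (list I) (fun l x =>
      near x (fun x' => forall y, L y -> exists i, In i l /\ U i (x', y)))) as [ls Hls].
  - intros l. apply is_open_near.
  - intros x Hx. apply compact_tube; auto.
  - exists (concat ls). intros [x y] [Hx Hy]. destruct (Hls x Hx) as (l & Hl & Hnear).
    destruct (near_self Hnear y Hy) as (i & Hi & Hu).
    exists i. split; [|exact Hu]. apply in_concat. eauto.
Qed.

Lemma compact_segment (a b : R) : compact_set (fun t : R_line => a <= t <= b).
Proof.
  intros I U HU Hcov.
  destruct (classic (inhabited I)) as [[i0] | Hempty].
  2:{ exists nil. intros t Ht. destruct (Hcov t Ht) as [i _]. now destruct Hempty. }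
  set (index := fun t => epsilon (inhabits i0) (fun i => U i t)).
  assert (Hindex : forall t, a <= t <= b -> U (index t) t).
  { intros t Ht. apply (epsilon_spec (inhabits i0) (fun i => U i t)), Hcov, Ht. }
  set (family_of_cover := mkfamily (fun s => a <= s <= b) (fun s t => a <= s <= b /\ U (index s) t)
    (fun s Hs => match Hs with ex_intro _ _ h => proj1 h end)).
  destruct (compact_P3 a b family_of_cover) as (D & HcovD & l & Hl).
  - split.
    + intros t Ht. exists t. split; [exact Ht | now apply Hindex].
    + intros s t [Hs Ht]. destruct (HU (index s) t Ht) as (r & Hr & Hball).
      exists (mkposreal r Hr). intros t' Ht'. split; [exact Hs|]. apply Hball.
      simpl. now rewrite Rabs_minus_sym.
  - exists (map index l). intros t Ht. destruct (HcovD t Ht) as (s & [Hs Hu] & HD).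
    exists (index s). split; [|exact Hu]. apply in_map, Hl. split; assumption.
Qed.

Lemma htpy_uniformly_small {X : MetricSpace} (H : X -> R -> X) :
  compact_space X -> htpy_continuous H -> (forall x, H x 0 = x) ->
  forall eps, 0 < eps -> exists t, 0 < t <= 1 /\ forall x, dist x (H x t) < eps.
Proof.
  intros HX HH H0 eps Heps. pose proof (proj1 (htpy_continuous_iff H) HH) as HHc.
  destruct (compact_thickening (P := fun p : prod_space X R_line =>
      0 <= snd p <= 1 -> dist (fst p) (H (fst p) (snd p)) < eps)
    (compact_prod _ _ HX (compact_segment 0 0))) as (r & Hr & Hsmall).
  - intros [x t] [_ Ht]. simpl in Ht. replace t with 0 by lra.
    apply (near_mono (near_and (near_ball ((x, 0) : prod_space X R_line) (eps / 2) ltac:(lra))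
      (HHc (x, 0) ltac:(simpl; lra) (eps / 2) ltac:(lra)))).
    intros [x' t'] [Hd HHd] Ht'. specialize (HHd Ht'). simpl in *. rewrite H0 in HHd.
    pose proof (Rabs_pos (0 - t')). pose proof (dist_tri X x' x (H x' t')).
    rewrite (dist_sym X x' x) in *. lra.
  - pose proof (Rmin_l 1 (r / 2)). pose proof (Rmin_r 1 (r / 2)).
    assert (0 < Rmin 1 (r / 2)) by (apply Rmin_pos; lra).
    exists (Rmin 1 (r / 2)). split; [lra|]. intros x.
    apply (Hsmall (x, 0) (x, Rmin 1 (r / 2))); simpl; [split; [exact I | lra] | | lra].
    rewrite dist_refl, Rabs_left; lra.
Qed.

(** * Separability *)

Lemma separable_union_images {X Y W : MetricSpace} (f : X -> W) (g : Y -> W) :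
  separable X -> separable Y -> continuous f -> continuous g ->
  (forall w, range f w \/ range g w) -> separable W.
Proof.
  intros [s Hs] [s' Hs'] Hf Hg Hcov.
  exists (fun n => if Nat.even n then f (s (Nat.div2 n)) else g (s' (Nat.div2 n))).
  intros w r Hr. destruct (Hcov w) as [[x <-] | [y <-]].
  - destruct (Hf x r Hr) as (d & Hd & Hclose). destruct (Hs x d Hd) as (_ & [n <-] & Hn).
    exists (f (s n)). split; auto. exists (2 * n)%nat.
    now rewrite Nat.even_mul, Nat.div2_double.
  - destruct (Hg y r Hr) as (d & Hd & Hclose). destruct (Hs' y d Hd) as (_ & [n <-] & Hn).
    exists (g (s' n)). split; auto. exists (S (2 * n))%nat.
    rewrite Nat.even_succ, Nat.odd_mul, Nat.div2_succ_double. reflexivity.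
Qed.

Lemma separable_dense_image {X W : MetricSpace} (f : X -> W) :
  separable X -> continuous f -> dense (range f) -> separable W.
Proof.
  intros [s Hs] Hf Hdense. exists (fun n => f (s n)). intros w r Hr.
  destruct (Hdense w (r / 2) ltac:(lra)) as (_ & [x <-] & Hx).
  destruct (Hf x (r / 2) ltac:(lra)) as (d & Hd & Hclose).
  destruct (Hs x d Hd) as (_ & [n <-] & Hn). specialize (Hclose (s n) Hn).
  exists (f (s n)). split; [eauto|]. pose proof (dist_tri W w (f x) (f (s n))). lra.
Qed.

Lemma separable_prod {X Y : MetricSpace} :
  separable X -> separable Y -> separable (prod_space X Y).
Proof.
  intros [s Hs] [s' Hs'].
  exists (fun n => (s (fst (Cantor.of_nat n)), s' (snd (Cantor.of_nat n)))).
  intros [x y] r Hr.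
  destruct (Hs x (r / 2) ltac:(lra)) as (_ & [n <-] & Hn).
  destruct (Hs' y (r / 2) ltac:(lra)) as (_ & [m <-] & Hm).
  exists (s n, s' m). split; [|simpl; lra].
  exists (Cantor.to_nat (n, m)). now rewrite Cantor.cancel_of_to.
Qed.

Lemma separable_subspace {X : MetricSpace} (P : X -> Prop) :
  separable X -> (exists x, P x) -> separable (subspace X P).
Proof.
  intros [s Hs] [x0 Hx0].
  set (pick := fun n m => epsilon (inhabits (exist P x0 Hx0 : subspace X P))
    (fun p => dist (s n) (proj1_sig p) < / INR m)).
  exists (fun i => pick (fst (Cantor.of_nat i)) (snd (Cantor.of_nat i))).
  intros p r Hr. destruct (archimed_cor1 (r / 2) ltac:(lra)) as (m & Hm & Hm0).
  assert (Hpos : 0 < / INR m) by now apply Rinv_0_lt_compat, lt_0_INR.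
  destruct (Hs (proj1_sig p) (/ INR m) Hpos) as (_ & [n <-] & Hn).
  exists (pick n m). split.
  - exists (Cantor.to_nat (n, m)). now rewrite Cantor.cancel_of_to.
  - assert (Hpick : dist (s n) (proj1_sig (pick n m)) < / INR m).
    { apply (epsilon_spec (inhabits (exist P x0 Hx0 : subspace X P))
        (fun p => dist (s n) (proj1_sig p) < / INR m)).
      exists p. now rewrite dist_sym. }
    simpl. pose proof (dist_tri X (proj1_sig p) (s n) (proj1_sig (pick n m))). lra.
Qed.

Lemma separable_R_line : separable R_line.
Proof.
  exists (fun i => let (a, i') := Cantor.of_nat i in let (b, m) := Cantor.of_nat i' in
    (INR a - INR b) / INR m).
  intros x r Hr. destruct (archimed_cor1 r Hr) as (m & Hm & Hm0).
  assert (HINR : 0 < INR m) by now apply lt_0_INR.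
  pose proof (archimed (x * INR m)) as [Hlo Hhi]. set (z := up (x * INR m)) in *.
  exists (IZR z / INR m). split.
  - exists (Cantor.to_nat (Z.to_nat z, Cantor.to_nat (Z.to_nat (- z), m))).
    rewrite !Cantor.cancel_of_to, !INR_IZR_INZ, <- minus_IZR. do 2 f_equal. lia.
  - simpl. replace (x - IZR z / INR m) with ((x * INR m - IZR z) * / INR m) by (field; lra).
    rewrite Rabs_mult, (Rabs_right (/ INR m)) by (apply Rle_ge; left; now apply Rinv_0_lt_compat).
    apply Rle_lt_trans with (2 := Hm). rewrite <- (Rmult_1_l (/ INR m)) at 2.
    apply Rmult_le_compat_r; [left; now apply Rinv_0_lt_compat|]. apply Rabs_le. lra.
Qed.

(** * Absolute retracts *)

Definition sup_dist {I : Type} (u v : I -> R) : R :=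
  sup01 (fun r => exists i, r = Rabs (u i - v i)).

Lemma sup_dist_le {I : Type} (u v : I -> R) (b : R) :
  0 <= b -> (forall i, Rabs (u i - v i) <= b) -> sup_dist u v <= b.
Proof. intros Hb Hle. apply sup01_le; [exact Hb|]. intros r [i ->] _. apply Hle. Qed.

Lemma sup_dist_ge {I : Type} (u v : {w : I -> R | forall i, 0 <= w i <= 1}) (i : I) :
  Rabs (proj1_sig u i - proj1_sig v i) <= sup_dist (proj1_sig u) (proj1_sig v).
Proof.
  apply sup01_ge; [eauto|]. pose proof (proj2_sig u i) as Hu. pose proof (proj2_sig v i) as Hv.
  simpl in Hu, Hv. apply Rabs_le. lra.
Qed.

Definition cube (I : Type) : MetricSpace.
Proof.
  refine {| mcar := {w : I -> R | forall i, 0 <= w i <= 1};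
            dist := fun u v => sup_dist (proj1_sig u) (proj1_sig v) |}.
  - intros u. apply Rle_antisym; [|apply sup01_bounds].
    apply sup_dist_le; [lra|]. intros i. rewrite Rminus_diag, Rabs_R0. lra.
  - intros u v Huv.
    assert (Heq : proj1_sig u = proj1_sig v).
    { extensionality i. pose proof (sup_dist_ge u v i) as Hi. rewrite Huv in Hi.
      exact (@eq_of_dist_le_0 R_line _ _ Hi). }
    destruct u as [u Hu], v as [v Hv]. simpl in Heq. subst v. f_equal. apply proof_irrelevance.
  - intros u v. unfold sup_dist. f_equal. extensionality r. f_equal. extensionality i.
    now rewrite Rabs_minus_sym.
  - intros u v w. apply sup_dist_le.
    + apply Rplus_le_le_0_compat; apply sup01_bounds.
    + intros i.
      pose proof (dist_tri R_line (proj1_sig u i) (proj1_sig v i) (proj1_sig w i)) as Htri.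
      simpl in Htri. pose proof (sup_dist_ge u v i). pose proof (sup_dist_ge v w i). lra.
Defined.

Lemma cube_dist_ge {I : Type} (u v : cube I) (i : I) :
  Rabs (proj1_sig u i - proj1_sig v i) <= dist u v.
Proof. apply sup_dist_ge. Qed.

Lemma cube_dist_le {I : Type} (u v : cube I) (b : R) :
  0 <= b -> (forall i, Rabs (proj1_sig u i - proj1_sig v i) <= b) -> dist u v <= b.
Proof. apply sup_dist_le. Qed.

Lemma cube_bounds {I : Type} (u : cube I) (i : I) : 0 <= proj1_sig u i <= 1.
Proof. exact (proj2_sig u i). Qed.

Definition kuratowski {X : MetricSpace} (x : X) : cube X :=
  exist (fun w => forall p, 0 <= w p <= 1)
    (fun p => dist_to (eq p) x) (fun p => dist_to_bounds (eq p) x).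

Lemma kuratowski_continuous (X : MetricSpace) : continuous (kuratowski (X := X)).
Proof.
  apply (lipschitz_continuous 1); [lra|]. intros x y. rewrite Rmult_1_l.
  apply cube_dist_le; [apply dist_nonneg|]. intros p. apply dist_to_lipschitz.
Qed.

Lemma kuratowski_dist_lt {X : MetricSpace} (x y : X) (r : R) :
  r <= 1 -> dist (kuratowski x) (kuratowski y) < r -> dist x y < r.
Proof.
  intros Hr Hlt. pose proof (cube_dist_ge (kuratowski x) (kuratowski y) y) as Hge.
  simpl proj1_sig in Hge. rewrite (dist_to_in (eq y) y), Rminus_0_r in Hge by reflexivity.
  rewrite Rabs_right in Hge by apply Rle_ge, dist_to_bounds.
  destruct (dist_to_approx (eq y) x r) as (z & <- & Hz); [lra | exact Hz].
Qed.

Section Tietze.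
Context {Y : MetricSpace} (A : Y -> Prop) (A_closed : is_closed A).

(* Hausdorff's extension formula. *)
Definition hausdorff_ext (v : Y -> R) (y : Y) : R :=
  sup01 (fun r => exists a, A a /\ r = Rmin (v a) (2 - dist y a / dist_to A y)).

Lemma hausdorff_ext_ge (v : Y -> R) (y a : Y) :
  v a <= 1 -> A a -> Rmin (v a) (2 - dist y a / dist_to A y) <= hausdorff_ext v y.
Proof.
  intros Hv Ha. apply sup01_ge; [eauto|]. pose proof (Rmin_l (v a) (2 - dist y a / dist_to A y)).
  lra.
Qed.

Lemma hausdorff_ext_near_boundary (v : Y -> R) (y : Y) (c e : R) :
  (forall a, v a <= 1) -> 0 <= c <= 1 -> 0 < e <= 1 -> ~ A y -> dist_to A y < 1 ->
  (forall a, A a -> dist y a < 2 * dist_to A y -> Rabs (v a - c) < e) ->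
  Rabs (hausdorff_ext v y - c) <= e.
Proof.
  intros Hv Hc He Hy Hy1 Hclose. pose proof (dist_to_pos A y A_closed Hy) as Hpos.
  apply Rabs_le. split.
  - destruct (dist_to_approx A y (Rmin 1 ((1 + e) * dist_to A y))) as (a & Ha & Hdist).
    { split; [apply Rmin_glb_lt; nra | apply Rmin_l]. }
    pose proof (Rmin_r 1 ((1 + e) * dist_to A y)).
    pose proof (Rabs_def2 _ _ (Hclose a Ha ltac:(nra))).
    assert (dist y a / dist_to A y <= 1 + e) by (apply Rdiv_le_of_le_mul; lra).
    assert (c - e <= Rmin (v a) (2 - dist y a / dist_to A y)) by (apply Rmin_glb; lra).
    pose proof (hausdorff_ext_ge v y a (Hv a) Ha). lra.
  - assert (hausdorff_ext v y <= c + e); [|lra].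
    apply sup01_le; [lra|]. intros r (a & Ha & ->) _.
    destruct (Rlt_or_le (dist y a) (2 * dist_to A y)) as [Hnear | Hfar].
    + pose proof (Rabs_def2 _ _ (Hclose a Ha Hnear)).
      pose proof (Rmin_l (v a) (2 - dist y a / dist_to A y)). lra.
    + pose proof (Rle_div_of_mul_le _ _ _ Hpos Hfar).
      pose proof (Rmin_r (v a) (2 - dist y a / dist_to A y)). lra.
Qed.

Lemma hausdorff_ext_le_add (v : Y -> R) (y y' : Y) (e : R) :
  (forall a, v a <= 1) -> ~ A y -> ~ A y' -> 0 < e <= 1 -> 4 * dist y y' <= e * dist_to A y ->
  hausdorff_ext v y <= hausdorff_ext v y' + e.
Proof.
  intros Hv Hy Hy' He Hyy'.
  pose proof (dist_to_pos A y A_closed Hy) as Hpos.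
  pose proof (dist_to_pos A y' A_closed Hy') as Hpos'.
  assert (Hbounds : 0 <= hausdorff_ext v y' <= 1) by apply sup01_bounds.
  apply sup01_le; [lra|]. intros r (a & Ha & ->) _.
  pose proof (hausdorff_ext_ge v y' a (Hv a) Ha) as Hterm.
  pose proof (Rmin_l (v a) (2 - dist y a / dist_to A y)).
  pose proof (Rmin_r (v a) (2 - dist y a / dist_to A y)).
  destruct (Rle_or_lt (dist y a / dist_to A y) 2) as [Hle | Hgt]; [|lra].
  assert (Hratio : dist y' a / dist_to A y' <= dist y a / dist_to A y + e).
  { pose proof (dist_to_le_add A y y'). pose proof (dist_nonneg y y').
    pose proof (dist_tri Y y' y a) as Htri. rewrite (dist_sym Y y' y) in Htri.
    assert (0 <= dist y a / dist_to A y).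
    { apply Rle_div_of_mul_le; [exact Hpos|]. rewrite Rmult_0_l. apply dist_nonneg. }
    assert (dist y a = dist y a / dist_to A y * dist_to A y) by (field; lra).
    apply Rdiv_le_of_le_mul; [exact Hpos'|]. nra. }
  revert Hterm. apply Rmin_case; lra.
Qed.

Context {I : Type} (u : Y -> cube I).

Definition cube_ext_coord (y : Y) (i : I) : R :=
  if excluded_middle_informative (A y) then proj1_sig (u y) i
  else hausdorff_ext (fun a => proj1_sig (u a) i) y.

Lemma cube_ext_coord_bounds (y : Y) (i : I) : 0 <= cube_ext_coord y i <= 1.
Proof.
  unfold cube_ext_coord. destruct (excluded_middle_informative (A y)).
  - apply cube_bounds.
  - apply sup01_bounds.
Qed.

Definition cube_ext (y : Y) : cube I :=
  exist (fun w => forall i, 0 <= w i <= 1) (cube_ext_coord y) (cube_ext_coord_bounds y).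

Lemma cube_ext_in (y : Y) : A y -> cube_ext y = u y.
Proof.
  intros Hy. apply eq_of_dist_le_0, cube_dist_le; [lra|]. intros i. simpl.
  unfold cube_ext_coord. destruct (excluded_middle_informative (A y)); [|contradiction].
  rewrite Rminus_diag, Rabs_R0. lra.
Qed.

Lemma cube_ext_out (y : Y) (i : I) :
  ~ A y -> proj1_sig (cube_ext y) i = hausdorff_ext (fun a => proj1_sig (u a) i) y.
Proof.
  intros Hy. simpl. unfold cube_ext_coord.
  now destruct (excluded_middle_informative (A y)).
Qed.

Lemma cube_ext_near_boundary (y : Y) (e : R) :
  continuous_on A u -> A y -> 0 < e <= 1 ->
  near y (fun y' => dist (cube_ext y) (cube_ext y') <= e).
Proof.
  intros Hu Hy He. destruct (Hu y Hy e ltac:(lra)) as (d & Hd & Hclose).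
  apply (near_mono (near_and (near_ball y (d / 3) ltac:(lra)) (near_ball y 1 ltac:(lra)))).
  intros y' [Hyd Hy1]. rewrite (cube_ext_in y Hy).
  destruct (classic (A y')) as [Hy' | Hy'].
  - rewrite (cube_ext_in y' Hy'). left. apply Hclose; [lra | exact Hy'].
  - apply cube_dist_le; [lra|]. intros i. rewrite (cube_ext_out y' i Hy'), Rabs_minus_sym.
    pose proof (dist_to_le A y' y Hy) as Hle. rewrite dist_sym in Hle.
    apply hausdorff_ext_near_boundary; auto; [| | lra |].
    + intros a. apply cube_bounds.
    + apply cube_bounds.
    + intros a Ha Hya. rewrite Rabs_minus_sym.
      eapply Rle_lt_trans; [apply cube_dist_ge|]. apply Hclose; [|exact Ha].
      pose proof (dist_tri Y y y' a). lra.
Qed.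

Lemma cube_ext_near_outside (y : Y) (e : R) :
  ~ A y -> 0 < e <= 1 -> near y (fun y' => dist (cube_ext y) (cube_ext y') <= e).
Proof.
  intros Hy He. pose proof (dist_to_pos A y A_closed Hy) as Hpos.
  exists (e * dist_to A y / 8). split; [nra|]. intros y' Hyy'.
  pose proof (dist_to_le_add A y y').
  assert (Hfar : dist_to A y / 2 < dist_to A y') by nra.
  assert (Hy' : ~ A y') by (intros Hy'; rewrite (dist_to_in A y' Hy') in Hfar; lra).
  apply cube_dist_le; [lra|]. intros i. rewrite (cube_ext_out y i Hy), (cube_ext_out y' i Hy').
  assert (Hv : forall a, proj1_sig (u a) i <= 1) by (intros a; apply cube_bounds).
  pose proof (hausdorff_ext_le_add _ y y' e Hv Hy Hy' He ltac:(nra)).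
  pose proof (hausdorff_ext_le_add _ y' y e Hv Hy' Hy He ltac:(rewrite dist_sym; nra)).
  apply Rabs_le. lra.
Qed.

Lemma cube_ext_continuous : continuous_on A u -> continuous cube_ext.
Proof.
  intros Hu y eps Heps.
  assert (He : 0 < Rmin 1 (eps / 2) <= 1) by (split; [apply Rmin_pos; lra | apply Rmin_l]).
  assert (Hnear : near y (fun y' => dist (cube_ext y) (cube_ext y') <= Rmin 1 (eps / 2))).
  { destruct (classic (A y)).
    - now apply cube_ext_near_boundary.
    - now apply cube_ext_near_outside. }
  apply (near_mono Hnear). intros y' Hy'. pose proof (Rmin_r 1 (eps / 2)). lra.
Qed.
End Tietze.

Section Adjunction.
Context {X Y : MetricSpace} (A : Y -> Prop) (A_closed : is_closed A)
  (u : Y -> X) (u_continuous : continuous_on A u).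

Definition adjunction_right (y : Y) : prod_space (cube X) R_line :=
  (cube_ext A (fun a => kuratowski (u a)) y, dist_to A y).

Definition adjunction_left (x : X) : prod_space (cube X) R_line := (kuratowski x, 0).

(* A copy of [X] with [Y] attached along [u]; the last coordinate, the distance to [A] on [Y]
   and zero on [X], makes [X] closed. *)
Definition adjunction : MetricSpace :=
  subspace (prod_space (cube X) R_line)
    (fun q => range adjunction_right q \/ range adjunction_left q).

Definition adjunction_inr (y : Y) : adjunction :=
  exist _ (adjunction_right y) (or_introl (range_intro adjunction_right y)).

Definition adjunction_inl (x : X) : adjunction :=
  exist _ (adjunction_left x) (or_intror (range_intro adjunction_left x)).

Lemma adjunction_inr_in (a : Y) : A a -> adjunction_inr a = adjunction_inl (u a).
Proof.
  intros Ha. apply subspace_eq. simpl. unfold adjunction_right, adjunction_left.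
  now rewrite cube_ext_in, dist_to_in.
Qed.

Lemma adjunction_inr_continuous : continuous adjunction_inr.
Proof.
  apply (continuous_pair (X := cube X) (Y := R_line)); [|apply dist_to_continuous].
  apply cube_ext_continuous; [exact A_closed|].
  apply (continuous_on_comp (E := fun _ => True) u_continuous); [|auto].
  apply continuous_continuous_on, kuratowski_continuous.
Qed.

Lemma adjunction_inl_continuous : continuous adjunction_inl.
Proof.
  apply (continuous_pair (X := cube X) (Y := R_line)).
  - apply kuratowski_continuous.
  - apply (constant_continuous (Y := R_line)).
Qed.

Lemma adjunction_inl_closed : is_closed (range adjunction_inl).
Proof.
  apply (is_closed_iff (fun q : adjunction => snd (proj1_sig q) <= 0)).
  - intros q. split; [|intros [x <-]; simpl; lra].
    destruct q as [q [[y <-] | [x <-]]]; intros Hq.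
    + simpl in Hq. destruct (classic (A y)) as [Hy | Hy].
      * exists (u y). rewrite <- adjunction_inr_in by exact Hy. now apply subspace_eq.
      * pose proof (dist_to_pos A y A_closed Hy). lra.
    + exists x. now apply subspace_eq.
  - apply (is_closed_le (fun q : adjunction => snd (proj1_sig q)) (fun _ => 0)).
    + exact (continuous_comp (proj1_sig_continuous _) (snd_continuous (cube X) R_line)).
    + apply constant_continuous.
Qed.

Lemma adjunction_inl_closed_embedding : closed_embedding adjunction_inl.
Proof.
  apply closed_embedding_of_inverse_modulus.
  - exact adjunction_inl_continuous.
  - exact adjunction_inl_closed.
  - intros x eps Heps. exists (Rmin 1 eps). split; [apply Rmin_pos; lra|]. intros x' Hd.
    apply Rlt_le_trans with (Rmin 1 eps); [|apply Rmin_r].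
    apply kuratowski_dist_lt; [apply Rmin_l|]. simpl in *.
    rewrite Rminus_diag, Rabs_R0 in Hd. lra.
Qed.

Lemma adjunction_separable : separable X -> separable Y -> separable adjunction.
Proof.
  intros HX HY.
  apply (separable_union_images adjunction_inr adjunction_inl HY HX
    adjunction_inr_continuous adjunction_inl_continuous).
  intros [q [[y Hy] | [x Hx]]]; [left; exists y | right; exists x]; now apply subspace_eq.
Qed.
End Adjunction.

Lemma AR_extension {X Y : MetricSpace} (A : Y -> Prop) (u : Y -> X) :
  AR X -> separable Y -> is_closed A -> continuous_on A u ->
  exists F : Y -> X, continuous F /\ forall a, A a -> F a = u a.
Proof.
  intros [X_separable X_retract] Y_separable A_closed Hu.
  destruct (X_retract (adjunction A u)) with (j := adjunction_inl A u) as (r & Hr & Hrj).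
  - now apply adjunction_separable.
  - now apply adjunction_inl_closed_embedding.
  - exists (fun y => r (adjunction_inr A u y)). split.
    + apply (continuous_comp (adjunction_inr_continuous A A_closed u Hu) Hr).
    + intros a Ha. now rewrite (adjunction_inr_in A u a Ha).
Qed.

Lemma AR_extension_subspace {X Y : MetricSpace} (D A : Y -> Prop) (u : subspace Y D -> X) :
  AR X -> separable Y -> (exists y, D y) -> is_closed A ->
  continuous_on (fun p : subspace Y D => A (proj1_sig p)) u ->
  exists F : Y -> X, continuous_on D F /\ forall p, A (proj1_sig p) -> F (proj1_sig p) = u p.
Proof.
  intros HAR Y_separable HD A_closed Hu.
  destruct (AR_extension (fun p : subspace Y D => A (proj1_sig p)) u HAR) as (F & HF & HFu).
  - now apply separable_subspace.
  - exact (is_open_preimage _ (compl A) (proj1_sig_continuous D) A_closed).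
  - exact Hu.
  - destruct HAR as [[s _] _].
    destruct (continuous_on_extend_subspace D F (s O) HF) as (F' & HF' & HF'F).
    exists F'. split; [exact HF'|]. intros p Hp. rewrite HF'F. now apply HFu.
Qed.

Lemma AR_homeomorphism {X Y : MetricSpace} (e : X -> Y) :
  homeomorphism e -> AR X -> AR Y.
Proof.
  intros (e' & He & He' & He'e & Hee') [X_separable X_retract]. split.
  - apply (separable_dense_image e X_separable He). intros y r Hr.
    exists y. split; [exists (e' y); apply Hee' | now rewrite dist_refl].
  - intros W W_separable j (Hj & _ & j_inverse & j_closed).
    destruct (X_retract W W_separable (fun x => j (e x))) as (r & Hr & Hrj).
    + apply closed_embedding_of_inverse_modulus; [exact (continuous_comp He Hj) | |].
      * apply (is_closed_iff (range j)); [|exact j_closed].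
        intros w. split; [intros [y <-]; exists (e' y); now rewrite Hee'|].
        intros [x <-]. apply range_intro.
      * intros x eps Heps. destruct (He' (e x) eps Heps) as (d & Hd & Hclose).
        destruct (j_inverse (e x) d Hd) as (d' & Hd' & Hinv). exists d'. split; [exact Hd'|].
        intros x' Hx'. rewrite <- (He'e x), <- (He'e x'). auto.
    + exists (fun w => e (r w)). split; [exact (continuous_comp Hr He)|].
      intros y. rewrite <- (Hee' y) at 1. rewrite Hrj. apply Hee'.
Qed.

(** * Retractions from homotopies off a subset *)

Section SlowFunction.
Context (rho : R -> R)
  (rho_pos : forall t, 0 < t <= 1 -> 0 < rho t)
  (rho_mono : forall t t', 0 < t <= t' -> t' <= 1 -> rho t <= rho t').

(* The supremum of functions [c] with [c s <= c s' <= (s' / s) * c s] for [s <= s'] inherits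
   this property, which makes it continuous on the positive reals. *)
Definition envelope (s : R) : R :=
  sup01 (fun r => exists t, 0 < t <= 1 /\ r = Rmin t (s / rho t)).

Lemma envelope_ge (s t : R) : 0 < t <= 1 -> Rmin t (s / rho t) <= envelope s.
Proof. intros Ht. apply sup01_ge; [eauto|]. pose proof (Rmin_l t (s / rho t)). lra. Qed.

Lemma envelope_bounds (s : R) : 0 <= envelope s <= 1.
Proof. apply sup01_bounds. Qed.

Lemma envelope_mono (s s' : R) : s <= s' -> envelope s <= envelope s'.
Proof.
  intros Hs. apply sup01_le; [apply sup01_bounds|]. intros r (t & Ht & ->) _.
  apply Rle_trans with (2 := envelope_ge s' t Ht), Rle_min_compat_l.
  apply Rmult_le_compat_r; [left; now apply Rinv_0_lt_compat, rho_pos | exact Hs].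
Qed.

Lemma envelope_scale (s s' : R) : 0 < s <= s' -> s * envelope s' <= s' * envelope s.
Proof.
  intros Hs. pose proof (envelope_bounds s).
  assert (Hratio : 1 <= s' / s) by (apply Rle_div_of_mul_le; lra).
  assert (Hscaled : envelope s' <= s' / s * envelope s).
  { apply sup01_le; [nra|]. intros r (t & Ht & ->) _.
    pose proof (rho_pos t Ht). pose proof (envelope_ge s t Ht) as Hterm.
    apply Rle_trans with (s' / s * Rmin t (s / rho t)); [|nra].
    assert (s' / s * (s / rho t) = s' / rho t) by (field; lra).
    revert Hterm. apply (Rmin_case t (s / rho t)); intros _.
    - apply Rle_trans with (1 := Rmin_l _ _). nra.
    - apply Rle_trans with (1 := Rmin_r _ _). lra. }
  replace (s' * envelope s) with (s * (s' / s * envelope s)) by (field; lra).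
  apply Rmult_le_compat_l; lra.
Qed.

Lemma envelope_increment (s s' : R) :
  0 < s <= s' -> s * Rabs (envelope s - envelope s') <= s' - s.
Proof.
  intros Hs. pose proof (envelope_mono s s' ltac:(lra)). pose proof (envelope_scale s s' Hs).
  pose proof (envelope_bounds s). rewrite Rabs_left1 by lra. nra.
Qed.

Lemma envelope_continuous : continuous_on (X := R_line) (Y := R_line) (fun s => 0 < s) envelope.
Proof.
  intros s Hs eps Heps.
  apply (near_mono (near_and (near_ball (s : R_line) (s / 2) ltac:(lra))
    (near_ball (s : R_line) (eps * s / 2) ltac:(nra)))).
  intros s' [Hhalf Hsmall] Hs'. simpl in *.
  pose proof (Rabs_pos (envelope s - envelope s')).
  apply Rabs_def2 in Hhalf, Hsmall. apply Rmult_lt_reg_l with (s / 2); [lra|].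
  destruct (Rle_or_lt s s').
  - pose proof (envelope_increment s s' ltac:(lra)). nra.
  - pose proof (envelope_increment s' s ltac:(lra)) as Hinc.
    rewrite Rabs_minus_sym in Hinc. nra.
Qed.

Lemma envelope_small (eps : R) :
  0 < eps <= 1 -> exists eta, 0 < eta /\ forall s, 0 < s < eta -> envelope s <= eps.
Proof.
  intros He. pose proof (rho_pos eps He). exists (eps * rho eps). split; [nra|].
  intros s Hs. apply sup01_le; [lra|]. intros r (t & Ht & ->) _.
  destruct (Rle_or_lt t eps) as [Hle | Hlt].
  - apply Rle_trans with (1 := Rmin_l _ _). exact Hle.
  - apply Rle_trans with (1 := Rmin_r _ _). apply Rdiv_le_of_le_mul; [now apply rho_pos|].
    pose proof (rho_mono eps t ltac:(lra) ltac:(lra)). nra.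
Qed.

Definition slow (s : R) : R := Rmin 1 (s + envelope s).

Lemma slow_bounds (s : R) : 0 < s -> 0 < slow s <= 1.
Proof.
  intros Hs. pose proof (envelope_bounds s).
  split; [apply Rmin_pos; lra | apply Rmin_l].
Qed.

Lemma slow_continuous : continuous_on (X := R_line) (Y := R_line) (fun s => 0 < s) slow.
Proof.
  intros s Hs eps Heps.
  apply (near_mono (near_and (near_ball (s : R_line) (eps / 2) ltac:(lra))
    (envelope_continuous s Hs (eps / 2) ltac:(lra)))).
  intros s' [Hclose Henv] Hs'. specialize (Henv Hs'). simpl in *.
  apply Rabs_def2 in Hclose, Henv. apply Rabs_def1;
    unfold slow; do 2 apply Rmin_case_strong; lra.
Qed.

Lemma slow_small (eps : R) :
  0 < eps -> exists eta, 0 < eta /\ forall s, 0 < s < eta -> slow s < eps.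
Proof.
  intros Heps. destruct (envelope_small (Rmin 1 (eps / 2))) as (eta & Heta & Hsmall).
  { split; [apply Rmin_pos; lra | apply Rmin_l]. }
  exists (Rmin eta (eps / 2)). split; [apply Rmin_pos; lra|]. intros s Hs.
  pose proof (Rmin_l eta (eps / 2)). pose proof (Rmin_r eta (eps / 2)).
  pose proof (Rmin_r 1 (eps / 2)). specialize (Hsmall s ltac:(lra)).
  apply Rle_lt_trans with (1 := Rmin_r _ _). lra.
Qed.

Lemma lt_rho_slow (s : R) : 0 < s -> slow s < 1 -> s < rho (slow s).
Proof.
  intros Hs Hlt. pose proof (slow_bounds s Hs) as Hb.
  assert (Heq : slow s = s + envelope s).
  { unfold slow in *. revert Hlt. apply Rmin_case; lra. }
  apply Rnot_le_lt. intros Hle. pose proof (rho_pos _ Hb).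
  pose proof (envelope_ge s (slow s) Hb) as Hterm.
  assert (1 <= s / rho (slow s)) by (apply Rle_div_of_mul_le; lra).
  rewrite Rmin_left in Hterm by lra. lra.
Qed.
End SlowFunction.

Section Retraction.
Context {Xh Y : MetricSpace} (h : Xh -> R -> Xh) (j : Xh -> Y) (phi : Y -> R -> Xh)
  (Xh_compact : compact_space Xh)
  (h_continuous : htpy_continuous h) (h_0 : forall x, h x 0 = x)
  (j_closed_embedding : closed_embedding j)
  (phi_continuous : continuous_on (fun p : prod_space Y R_line => 0 < snd p <= 1)
     (fun p => phi (fst p) (snd p)))
  (phi_j : forall x t, 0 < t <= 1 -> phi (j x) t = h x t).

Definition tracks (y : Y) (t : R) : Prop :=
  exists x, dist (j x) y < t /\ dist (phi y t) (h x t) < t.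

Lemma range_closed : is_closed (range j).
Proof. apply j_closed_embedding. Qed.

Lemma tracks_near_range (x : Xh) (t : R) :
  0 < t <= 1 ->
  near ((j x, t) : prod_space Y R_line) (fun p => 0 < snd p <= 1 -> tracks (fst p) (snd p)).
Proof.
  intros Ht. destruct (h_continuous x t ltac:(lra) (t / 4) ltac:(lra)) as (d & Hd & Hclose).
  apply (near_mono (near_and (near_ball ((j x, t) : prod_space Y R_line) (t / 2) ltac:(lra))
    (near_and (near_ball ((j x, t) : prod_space Y R_line) d Hd)
      (phi_continuous (j x, t) Ht (t / 4) ltac:(lra))))).
  intros [y s] (Hhalf & Hdist & Hphi) Hs. specialize (Hphi Hs).
  simpl in Hhalf, Hdist, Hphi, Hs |- *. rewrite (phi_j x t Ht) in Hphi.
  pose proof (dist_nonneg (j x) y). pose proof (Rabs_pos (t - s)).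
  pose proof (Rabs_def2 (t - s) (t / 2) ltac:(lra)).
  specialize (Hclose x s ltac:(lra) ltac:(rewrite dist_refl; lra) ltac:(lra)).
  exists x. split; [lra|].
  pose proof (dist_tri Xh (phi y s) (h x t) (h x s)).
  rewrite (dist_sym Xh (phi y s) (h x t)) in *. lra.
Qed.

Lemma tracks_uniformly (t0 : R) :
  0 < t0 <= 1 ->
  exists s, 0 < s <= 1 /\ forall y t, t0 <= t <= 1 -> dist_to (range j) y < s -> tracks y t.
Proof.
  intros Ht0.
  destruct (compact_thickening
    (P := fun p : prod_space Y R_line => 0 < snd p <= 1 -> tracks (fst p) (snd p))
    (compact_prod _ _ (compact_image j _
        (continuous_continuous_on _ j (proj1 j_closed_embedding)) Xh_compact)
      (compact_segment t0 1))) as (r & Hr & Htracks).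
  - intros [y t] [(x & _ & Hx) Ht]. simpl in Hx, Ht. subst y. apply tracks_near_range. lra.
  - exists (Rmin r 1). split; [split; [apply Rmin_pos; lra | apply Rmin_r]|].
    intros y t Ht Hy. pose proof (Rmin_l r 1). pose proof (Rmin_r r 1).
    destruct (dist_to_approx (range j) y (Rmin r 1)) as (_ & [x <-] & Hx); [lra|].
    apply (Htracks (j x, t) (y, t)); simpl; [split; [now apply image_intro | lra] | | lra].
    rewrite dist_sym, Rminus_diag, Rabs_R0. lra.
Qed.

Definition track_radius (t : R) : R :=
  sup01 (fun s => forall y t', t <= t' <= 1 -> dist_to (range j) y < s -> tracks y t').

Lemma track_radius_pos (t : R) : 0 < t <= 1 -> 0 < track_radius t.
Proof.
  intros Ht. destruct (tracks_uniformly t Ht) as (s & Hs & Htracks).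
  apply Rlt_le_trans with s; [lra|]. apply sup01_ge; [exact Htracks | lra].
Qed.

Lemma track_radius_mono (t t' : R) : t <= t' -> track_radius t <= track_radius t'.
Proof.
  intros Ht. apply sup01_le; [apply sup01_bounds|]. intros s Hs Hs1.
  apply sup01_ge; [|exact Hs1]. intros y t1 Ht1. apply Hs. lra.
Qed.

Lemma tracks_of_lt_radius (y : Y) (t : R) :
  t <= 1 -> dist_to (range j) y < track_radius t -> tracks y t.
Proof.
  intros Ht Hy.
  destruct (sup01_lt _ _ (proj1 (dist_to_bounds (range j) y)) Hy) as (s & Hs & _ & Hlt).
  apply Hs; [lra | exact Hlt].
Qed.

Definition height (y : Y) : R := slow track_radius (dist_to (range j) y).

Lemma height_bounds (y : Y) : ~ range j y -> 0 < height y <= 1.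
Proof. intros Hy. now apply slow_bounds, dist_to_pos; [apply range_closed|]. Qed.

Lemma height_tracks (y : Y) : ~ range j y -> height y < 1 -> tracks y (height y).
Proof.
  intros Hy Hlt. pose proof (height_bounds y Hy). apply tracks_of_lt_radius; [lra|].
  apply lt_rho_slow; [exact track_radius_pos | now apply dist_to_pos; [apply range_closed|] |].
  exact Hlt.
Qed.

Lemma height_small (x : Xh) (eps : R) :
  0 < eps -> near (j x) (fun y => ~ range j y -> height y < eps).
Proof.
  intros Heps.
  destruct (slow_small track_radius track_radius_pos
    (fun t t' Ht _ => track_radius_mono t t' (proj2 Ht)) eps Heps) as (eta & Heta & Hsmall).
  apply (near_mono (near_ball (j x) eta Heta)). intros y Hxy Hy. apply Hsmall.
  split; [now apply dist_to_pos; [apply range_closed|]|].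
  rewrite dist_sym in Hxy. apply Rle_lt_trans with (2 := Hxy), dist_to_le. now exists x.
Qed.

Lemma tracks_close (x : Xh) (eps : R) :
  0 < eps -> near ((j x, 0) : prod_space Y R_line) (fun p =>
    0 < snd p <= 1 -> tracks (fst p) (snd p) -> dist x (phi (fst p) (snd p)) < eps).
Proof.
  intros Heps. destruct j_closed_embedding as (_ & _ & j_inverse & _).
  destruct (h_continuous x 0 ltac:(lra) (eps / 2) ltac:(lra)) as (d & Hd & Hclose).
  rewrite h_0 in Hclose. destruct (j_inverse x d Hd) as (e & He & Hinv).
  set (p0 := (j x, 0) : prod_space Y R_line).
  apply (near_mono (near_and (near_ball p0 d Hd)
    (near_and (near_ball p0 (e / 2) ltac:(lra)) (near_ball p0 (eps / 2) ltac:(lra))))).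
  intros [y t] (Hd' & He' & Heps') Ht (x' & Hx' & Hphi). simpl in *.
  rewrite Rminus_0_l, Rabs_Ropp, Rabs_right in * by lra. pose proof (dist_nonneg (j x) y).
  pose proof (dist_tri Y (j x) y (j x')). rewrite (dist_sym Y y (j x')) in *.
  assert (Hxx' : dist x x' < d) by (apply Hinv; lra).
  specialize (Hclose x' t ltac:(lra) Hxx' ltac:(apply Rabs_def1; lra)).
  pose proof (dist_tri Xh x (h x' t) (phi y t)).
  rewrite (dist_sym Xh (h x' t) (phi y t)) in *. lra.
Qed.

Definition tracking_retraction (y : Y) : Xh :=
  match excluded_middle_informative (range j y) with
  | left hy => proj1_sig (constructive_indefinite_description _ hy)
  | right _ => phi y (height y)
  end.

Lemma tracking_retraction_j (x : Xh) : tracking_retraction (j x) = x.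
Proof.
  unfold tracking_retraction. destruct (excluded_middle_informative _) as [hx | hx].
  - apply j_closed_embedding. exact (proj2_sig (constructive_indefinite_description _ hx)).
  - exfalso. apply hx. now exists x.
Qed.

Lemma tracking_retraction_out (y : Y) : ~ range j y -> tracking_retraction y = phi y (height y).
Proof.
  intros Hy. unfold tracking_retraction.
  now destruct (excluded_middle_informative (range j y)).
Qed.

Lemma tracking_retraction_near_range (x : Xh) (eps : R) :
  0 < eps -> near (j x) (fun y => dist x (tracking_retraction y) < eps).
Proof.
  intros Heps. destruct (tracks_close x eps Heps) as (d & Hd & Hclose).
  destruct j_closed_embedding as (_ & _ & j_inverse & _).
  destruct (j_inverse x eps Heps) as (e & He & Hinv).
  apply (near_mono (near_and
    (near_and (near_ball (j x) (d / 2) ltac:(lra)) (near_ball (j x) e He))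
    (near_and (height_small x (d / 2) ltac:(lra)) (height_small x 1 Rlt_0_1)))).
  intros y [[Hyd Hye] [Hheight Hheight1]]. destruct (classic (range j y)) as [[x' <-] | Hy].
  - rewrite tracking_retraction_j. now apply Hinv.
  - rewrite tracking_retraction_out by exact Hy. pose proof (height_bounds y Hy).
    apply (Hclose (y, height y)); simpl; [|lra | now apply height_tracks; auto].
    specialize (Hheight Hy). rewrite Rminus_0_l, Rabs_Ropp, Rabs_right; lra.
Qed.

Lemma tracking_retraction_continuous_outside : continuous_on (compl (range j)) tracking_retraction.
Proof.
  apply (continuous_on_eq (f := fun y => phi y (height y))).
  - intros y Hy. symmetry. now apply tracking_retraction_out.
  - apply (continuous_on_comp (f := fun y => (y, height y) : prod_space Y R_line))
      with (2 := phi_continuous); [|exact height_bounds].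
    apply (continuous_on_pair (Y := R_line)).
    + apply continuous_continuous_on, id_continuous.
    + apply (continuous_on_comp (f := dist_to (range j) : Y -> R_line))
        with (2 := slow_continuous track_radius track_radius_pos).
      * apply continuous_continuous_on, dist_to_continuous.
      * intros y Hy. apply dist_to_pos; [apply range_closed | exact Hy].
Qed.

Lemma tracking_retraction_continuous : continuous tracking_retraction.
Proof.
  intros y eps Heps. destruct (classic (range j y)) as [[x <-] | Hy].
  - rewrite tracking_retraction_j. now apply tracking_retraction_near_range.
  - exact (continuous_on_open_near_ball range_closed tracking_retraction_continuous_outside
      Hy Heps).
Qed.
End Retraction.

(** * Compact spaces with a Z-set *)

Lemma Zset_dense_complement {X : MetricSpace} (Z : X -> Prop) :
  Zset Z -> dense (compl Z).
Proof.
  intros (_ & h & Hh & h_0 & h_avoids) x r Hr.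
  destruct (Hh x 0 ltac:(lra) r Hr) as (d & Hd & Hclose). rewrite h_0 in Hclose.
  pose proof (Rmin_l 1 (d / 2)). pose proof (Rmin_r 1 (d / 2)).
  assert (0 < Rmin 1 (d / 2)) by (apply Rmin_pos; lra).
  exists (h x (Rmin 1 (d / 2))). split; [apply h_avoids; lra|].
  apply Hclose; [lra | now rewrite dist_refl | apply Rabs_def1; lra].
Qed.

Lemma separable_of_dense {X : MetricSpace} (D : X -> Prop) :
  dense D -> separable (subspace X D) -> separable X.
Proof.
  intros Hdense Hsep.
  apply (separable_dense_image (fun p : subspace X D => proj1_sig p) Hsep).
  - apply proj1_sig_continuous.
  - intros x r Hr. destruct (Hdense x r Hr) as (y & Hy & Hxy).
    exists y. split; [now exists (exist _ y Hy) | exact Hxy].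
Qed.

Lemma half_open_homotopy_extension {X Y : MetricSpace} (Z : X -> Prop)
    (h : X -> R -> X) (j : X -> Y) :
  AR (subspace X (compl Z)) -> separable Y -> closed_embedding j ->
  htpy_continuous h -> (forall x t, 0 < t <= 1 -> ~ Z (h x t)) ->
  exists phi : Y -> R -> X,
    continuous_on (fun p : prod_space Y R_line => 0 < snd p <= 1) (fun p => phi (fst p) (snd p)) /\
    (forall x t, 0 < t <= 1 -> phi (j x) t = h x t).
Proof.
  intros HAR Y_separable Hj Hh h_avoids.
  pose proof HAR as [[s _] _]. set (x0 := proj1_sig (s O)).
  destruct (closed_embedding_left_inverse j x0 Hj) as (g & Hg & Hgj).
  set (half_open := fun p : prod_space Y R_line => 0 < snd p <= 1).
  set (range_cylinder := fun p : prod_space Y R_line => range j (fst p)).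
  set (u := fun p : subspace (prod_space Y R_line) half_open => exist (compl Z)
    (h (g (fst (proj1_sig p))) (snd (proj1_sig p))) (h_avoids _ _ (proj2_sig p))
    : subspace X (compl Z)).
  assert (Hpair : continuous_on (Y := prod_space X R_line) range_cylinder
      (fun p => (g (fst p), snd p))).
  { apply (continuous_on_pair (Y := R_line)).
    - exact (continuous_on_preimage (fst_continuous Y R_line) Hg).
    - apply continuous_continuous_on, snd_continuous. }
  destruct (AR_extension_subspace half_open range_cylinder u HAR) as (F & HF & HFu).
  - exact (separable_prod Y_separable separable_R_line).
  - exists (j x0, 1). unfold half_open. simpl. lra.
  - apply (is_open_preimage _ (compl (range j)) (fst_continuous Y R_line)). apply Hj.
  - change (continuous_on (Y := X) (fun p : subspace _ half_open => range_cylinder (proj1_sig p))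
      (fun p => proj1_sig (u p))).
    apply (continuous_on_comp (Y := prod_space X R_line)
      (f := fun p : subspace _ half_open => (g (fst (proj1_sig p)), snd (proj1_sig p))))
      with (2 := proj1 (htpy_continuous_iff h) Hh).
    + exact (continuous_on_preimage (proj1_sig_continuous half_open) Hpair).
    + intros [[y t] Ht] _. unfold half_open in Ht. simpl in *. lra.
  - exists (fun y t => proj1_sig (F (y, t))). split.
    + apply (continuous_on_eq (f := fun p => proj1_sig (F p))); [now intros [y t] _|].
      exact HF.
    + intros x t Ht. rewrite <- (Hgj x) at 2.
      exact (f_equal (@proj1_sig _ _) (HFu (exist half_open (j x, t) Ht) (range_intro j x))).
Qed.

Theorem AR_of_Zset {X : MetricSpace} (Z : X -> Prop) :
  compact_space X -> Zset Z -> AR (subspace X (compl Z)) -> AR X.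
Proof.
  intros HX HZ HAR. split.
  - apply (separable_of_dense (compl Z)); [now apply Zset_dense_complement | apply HAR].
  - intros Y Y_separable j Hj. destruct HZ as (_ & h & Hh & h_0 & h_avoids).
    destruct (half_open_homotopy_extension Z h j) as (phi & Hphi & Hphi_j); auto.
    exists (tracking_retraction h j phi). split.
    + now apply tracking_retraction_continuous.
    + now apply tracking_retraction_j.
Qed.

(** * Covering dimension *)

Definition open_cover {X : MetricSpace} (U : list (X -> Prop)) : Prop :=
  (forall V, In V U -> is_open V) /\ (forall x, exists V, In V U /\ V x).

Definition refines {X : MetricSpace} (W U : list (X -> Prop)) : Prop :=
  forall V, In V W -> exists V', In V' U /\ forall x, V x -> V' x.

Definition order_le {X : MetricSpace} (W : list (X -> Prop)) (n : nat) : Prop :=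
  forall x (idx : list nat), NoDup idx -> length idx = (n + 2)%nat ->
    (forall i, In i idx -> (i < length W)%nat) ->
    exists i, In i idx /\ ~ (nth i W (fun _ => False)) x.

Lemma dim_le_iff (X : MetricSpace) (n : nat) :
  dim_le X n <->
  forall U : list (X -> Prop), open_cover U ->
    exists W, open_cover W /\ refines W U /\ order_le W n.
Proof.
  split.
  - intros Hdim U [Uopen Ucov]. destruct (Hdim U Uopen Ucov) as (W & Wopen & Wcov & Wref & Word).
    exists W. repeat split; assumption.
  - intros Hdim U Uopen Ucov.
    destruct (Hdim U (conj Uopen Ucov)) as (W & [Wopen Wcov] & Wref & Word).
    exists W. repeat split; assumption.
Qed.

Definition preimage_list {X Y : Type} (f : X -> Y) (U : list (Y -> Prop)) : list (X -> Prop) :=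
  map (fun V x => V (f x)) U.

Lemma open_cover_preimage {X Y : MetricSpace} (f : X -> Y) (U : list (Y -> Prop)) :
  continuous f -> open_cover U -> open_cover (preimage_list f U).
Proof.
  intros Hf [Uopen Ucov]. split.
  - intros V' HV'. apply in_map_iff in HV' as (V & <- & HV).
    exact (is_open_preimage f V Hf (Uopen V HV)).
  - intros x. destruct (Ucov (f x)) as (V & HV & Hx). exists (fun x => V (f x)).
    split; [exact (in_map (fun V x => V (f x)) U V HV) | exact Hx].
Qed.

Lemma order_le_preimage {X Y : MetricSpace} (f : X -> Y) (W : list (Y -> Prop)) (n : nat) :
  order_le W n -> order_le (preimage_list f W) n.
Proof.
  intros Word x idx Hnodup Hlength Hidx. unfold preimage_list in *. rewrite length_map in Hidx.
  destruct (Word (f x) idx Hnodup Hlength Hidx) as (i & Hi & Hx).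
  exists i. split; [exact Hi|].
  change (fun _ : X => False) with ((fun (V : Y -> Prop) x => V (f x)) (fun _ => False)).
  now rewrite map_nth.
Qed.

Lemma dim_le_homeomorphism {X Y : MetricSpace} (e : X -> Y) (n : nat) :
  homeomorphism e -> dim_le X n -> dim_le Y n.
Proof.
  intros (e' & He & He' & He'e & Hee') Hdim. apply dim_le_iff. intros U HU.
  destruct (proj1 (dim_le_iff X n) Hdim (preimage_list e U)) as (W & HW & Wref & Word).
  { now apply open_cover_preimage. }
  exists (preimage_list e' W). split; [now apply open_cover_preimage|].
  split; [|now apply order_le_preimage].
  intros V' HV'. apply in_map_iff in HV' as (V & <- & HV).
  destruct (Wref V HV) as (V0' & HV0' & Hsub). apply in_map_iff in HV0' as (V0 & <- & HV0).
  exists V0. split; [exact HV0|]. intros y Hy. specialize (Hsub (e' y) Hy).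
  now rewrite Hee' in Hsub.
Qed.

Definition erosion {X : MetricSpace} (r : R) (V : X -> Prop) (x : X) : Prop :=
  exists s, r < s /\ forall y, dist x y < s -> V y.

Lemma is_open_erosion {X : MetricSpace} (r : R) (V : X -> Prop) : is_open (erosion r V).
Proof.
  intros x (s & Hs & Hball). exists ((s - r) / 2). split; [lra|].
  intros y Hxy. exists ((s + r) / 2). split; [lra|]. intros z Hyz. apply Hball.
  pose proof (dist_tri X x y z). lra.
Qed.

Lemma open_cover_erosion {X : MetricSpace} (U : list (X -> Prop)) :
  compact_space X -> open_cover U -> exists r, 0 < r /\ open_cover (map (erosion r) U).
Proof.
  intros HX [Uopen Ucov].
  destruct (lebesgue_number (fun _ => True) (fun V : {V | In V U} => proj1_sig V) HX)
    as (r & Hr & Hball).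
  - intros x _. destruct (Ucov x) as (V & HV & Hx). exists (exist _ V HV). exact (Uopen V HV x Hx).
  - exists (r / 2). split; [lra|]. split.
    + intros V' HV'. apply in_map_iff in HV' as (V & <- & _). apply is_open_erosion.
    + intros x. destruct (Hball x I) as [[V HV] Hx]. exists (erosion (r / 2) V).
      split; [now apply in_map|]. exists r. split; [lra | exact Hx].
Qed.

Lemma dim_le_approximate {X Y : MetricSpace} (n : nat) :
  compact_space Y -> dim_le X n ->
  (forall eps, 0 < eps -> exists (p : Y -> X) (i : X -> Y),
     continuous p /\ continuous i /\ forall y, dist y (i (p y)) < eps) ->
  dim_le Y n.
Proof.
  intros HY Hdim Happrox. apply dim_le_iff. intros U HU.
  destruct (open_cover_erosion U HY HU) as (r & Hr & Hcov).
  destruct (Happrox r Hr) as (p & i & Hp & Hi & Hclose).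
  destruct (proj1 (dim_le_iff X n) Hdim (preimage_list i (map (erosion r) U)))
    as (W & HW & Wref & Word).
  { now apply open_cover_preimage. }
  exists (preimage_list p W). split; [now apply open_cover_preimage|].
  split; [|now apply order_le_preimage].
  intros V' HV'. apply in_map_iff in HV' as (V & <- & HV).
  destruct (Wref V HV) as (V1 & HV1 & Hsub). unfold preimage_list in HV1.
  rewrite map_map in HV1. apply in_map_iff in HV1 as (V0 & <- & HV0).
  exists V0. split; [exact HV0|]. intros y Hy. destruct (Hsub (p y) Hy) as (s & Hs & Hball).
  apply Hball. rewrite dist_sym. apply Rlt_trans with (2 := Hs), Hclose.
Qed.

Lemma dim_le_of_Zset {X : MetricSpace} (Z : X -> Prop) (n : nat) :
  compact_space X -> Zset Z -> dim_le (subspace X (compl Z)) n -> dim_le X n.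
Proof.
  intros HX (_ & h & Hh & h_0 & h_avoids) Hdim.
  apply (dim_le_approximate n HX Hdim). intros eps Heps.
  destruct (htpy_uniformly_small h HX Hh h_0 eps Heps) as (t & Ht & Hsmall).
  exists (fun x => exist (compl Z) (h x t) (h_avoids x t Ht)), (@proj1_sig _ _).
  split; [|split; [apply proj1_sig_continuous | exact Hsmall]].
  intros x r Hr. destruct (Hh x t ltac:(lra) r Hr) as (d & Hd & Hclose).
  exists d. split; [exact Hd|]. intros x' Hx'. apply Hclose; [lra | exact Hx' |].
  now rewrite Rminus_diag, Rabs_R0.
Qed.

(** * Attaching a boundary along a map *)

Definition asymptotic_on {Y : MetricSpace} {S : Type} (Z : Y -> Prop)
    (D : S -> Prop) (u v : S -> Y) : Prop :=
  forall eps, 0 < eps -> exists d, 0 < d /\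
    forall s, D s -> dist_to Z (u s) < d -> dist (v s) (u s) < eps.

Lemma asymptotic_on_infinity {Y : MetricSpace} {S : Type} (Z : Y -> Prop)
    (D : S -> Prop) (u v : S -> Y) (s : S) :
  asymptotic_on Z D u v -> D s -> Z (u s) -> v s = u s.
Proof.
  intros Huv Hs Hz. apply eq_of_dist_le_0, Rnot_lt_le. intros Hpos.
  destruct (Huv _ Hpos) as (d & Hd & Hclose). apply (Rlt_irrefl (dist (v s) (u s))), Hclose.
  - exact Hs.
  - now rewrite dist_to_in.
Qed.

Section Glue.
Context {X Y : MetricSpace} {Z : Y -> Prop} (Z_closed : is_closed Z)
  (f : X -> subspace Y (compl Z)).

Definition base (p : X + {z | Z z}) : Y :=
  match p with inl x => proj1_sig (f x) | inr z => proj1_sig z end.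

Definition depth (p : X + {z | Z z}) : R := dist_to Z (base p).

Lemma depth_bounds (p : X + {z | Z z}) : 0 <= depth p <= 1.
Proof. apply dist_to_bounds. Qed.

Lemma depth_inr (z : {z | Z z}) : depth (inr z) = 0.
Proof. apply dist_to_in, (proj2_sig z). Qed.

Lemma depth_inl (x : X) : 0 < depth (inl x).
Proof. apply dist_to_pos; [exact Z_closed | exact (proj2_sig (f x))]. Qed.

Definition radial_coord (p : X + {z | Z z}) (x' : X) : R :=
  match p with inl x => depth p * dist_to (eq x') x | inr _ => 0 end.

Lemma radial_coord_le_depth (p : X + {z | Z z}) (x' : X) : 0 <= radial_coord p x' <= depth p.
Proof.
  pose proof (depth_bounds p). destruct p as [x|z]; simpl; [|lra].
  pose proof (dist_to_bounds (eq x') x). nra.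
Qed.

Lemma radial_coord_bounds (p : X + {z | Z z}) (x' : X) : 0 <= radial_coord p x' <= 1.
Proof. pose proof (radial_coord_le_depth p x'). pose proof (depth_bounds p). lra. Qed.

Definition radial (p : X + {z | Z z}) : cube X :=
  exist (fun w => forall x', 0 <= w x' <= 1) (radial_coord p) (radial_coord_bounds p).

(* The second component is the Kuratowski embedding of [X], scaled down to a point at [Z]. *)
Definition chart (p : X + {z | Z z}) : prod_space Y (cube X) := (base p, radial p).

Lemma chart_injective (p q : X + {z | Z z}) : chart p = chart q -> p = q.
Proof.
  intros Heq. pose proof (f_equal fst Heq) as Hbase. pose proof (f_equal snd Heq) as Hradial.
  destruct p as [x|z], q as [y|z']; simpl in Hbase.
  - pose proof (f_equal (fun w : cube X => proj1_sig w y) Hradial) as Hcoord.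
    simpl in Hcoord. rewrite (dist_to_in (eq y) y), Rmult_0_r in Hcoord by reflexivity.
    pose proof (depth_inl x). f_equal. apply eq_of_dist_to_eq_0. nra.
  - exfalso. apply (proj2_sig (f x)). rewrite Hbase. exact (proj2_sig z').
  - exfalso. apply (proj2_sig (f y)). rewrite <- Hbase. exact (proj2_sig z).
  - f_equal. destruct z, z'. simpl in Hbase. subst. f_equal. apply proof_irrelevance.
Qed.

Definition glue : MetricSpace := pullback chart chart_injective.

Lemma base_dist_le (p q : glue) : dist (base p) (base q) <= dist p q.
Proof. pose proof (dist_nonneg (radial p) (radial q)). simpl in *. lra. Qed.

Lemma base_continuous : continuous (base : glue -> Y).
Proof.
  apply (lipschitz_continuous (X := glue) 1); [lra|]. intros p q. rewrite Rmult_1_l.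
  apply base_dist_le.
Qed.

Lemma base_fst_continuous : continuous (fun q : prod_space glue R_line => base (fst q)).
Proof. exact (continuous_comp (fst_continuous glue R_line) base_continuous). Qed.

Lemma depth_fst_continuous :
  continuous ((fun q => depth (fst q)) : prod_space glue R_line -> R_line).
Proof. exact (continuous_comp base_fst_continuous (dist_to_continuous Z)). Qed.

Lemma depth_le_add (p q : glue) : depth p <= depth q + dist p q.
Proof.
  pose proof (dist_to_le_add Z (base p) (base q)). pose proof (base_dist_le p q).
  unfold depth. lra.
Qed.

Lemma glue_dist_le (p q : glue) : dist p q <= dist (base p) (base q) + depth p + depth q.
Proof.
  assert (Hradial : dist (radial p) (radial q) <= depth p + depth q).
  { pose proof (depth_bounds p). pose proof (depth_bounds q).
    apply cube_dist_le; [lra|]. intros x'. simpl.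
    pose proof (radial_coord_le_depth p x'). pose proof (radial_coord_le_depth q x').
    apply Rabs_le. lra. }
  change (dist (base p) (base q) + dist (radial p) (radial q) <=
    dist (base p) (base q) + depth p + depth q). lra.
Qed.

Lemma glue_dist_infinity (p q : glue) : Z (base p) -> dist p q <= 2 * dist (base p) (base q).
Proof.
  intros Hp. pose proof (glue_dist_le p q). pose proof (dist_to_le Z (base q) (base p) Hp).
  rewrite (dist_sym Y (base q)) in *. unfold depth in *. rewrite (dist_to_in Z (base p) Hp) in *.
  lra.
Qed.

Lemma inl_continuous : continuous f -> continuous (inl : X -> glue).
Proof.
  intros Hf x eps Heps.
  apply (near_mono (near_and (continuous_near_ball (eps := eps / 4) x Hf ltac:(lra))
    (near_ball x (eps / 4) ltac:(lra)))).
  intros y [Hfy Hy]. change (dist (base (inl x)) (base (inl y)) < eps / 4) in Hfy.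
  assert (Hradial : dist (radial (inl x)) (radial (inl y)) <= eps / 4 + eps / 4).
  { apply cube_dist_le; [lra|]. intros x'. simpl.
    pose proof (dist_to_le_add Z (base (inl x)) (base (inl y))).
    pose proof (dist_to_le_add Z (base (inl y)) (base (inl x))).
    rewrite (dist_sym Y (base (inl y))) in *. fold (depth (inl x)) (depth (inl y)) in *.
    pose proof (dist_to_le_add (eq x') x y). pose proof (dist_to_le_add (eq x') y x).
    rewrite (dist_sym X y x) in *.
    pose proof (dist_to_bounds (eq x') x). pose proof (dist_to_bounds (eq x') y).
    pose proof (depth_bounds (inl x)). pose proof (depth_bounds (inl y)).
    apply Rabs_le. nra. }
  change (dist (base (inl x)) (base (inl y)) + dist (radial (inl x)) (radial (inl y)) < eps). lra.
Qed.

Lemma near_inl (x : X) (P : X -> Prop) :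
  near x P -> near (inl x : glue) (fun p => exists y, p = inl y /\ P y).
Proof.
  intros (eps & Heps & HP). pose proof (depth_inl x) as Hpos.
  assert (He : 0 < Rmin 1 eps <= 1) by (split; [apply Rmin_pos; lra | apply Rmin_l]).
  exists (depth (inl x) * Rmin 1 eps / 2). split; [nra|]. intros p Hd.
  pose proof (depth_le_add (inl x) p).
  destruct p as [y|z]; [|rewrite depth_inr in *; nra].
  exists y. split; [reflexivity|]. apply HP.
  assert (Hcoord : depth (inl y) * dist_to (eq x) y <= dist (inl x : glue) (inl y)).
  { pose proof (cube_dist_ge (radial (inl x)) (radial (inl y)) x) as Hge. simpl in Hge.
    rewrite (dist_to_in (eq x) x), Rmult_0_r, Rminus_0_l, Rabs_Ropp in Hge by reflexivity.
    pose proof (Rle_abs (depth (inl y) * dist_to (eq x) y)).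
    pose proof (dist_nonneg (base (inl x)) (base (inl y))). simpl in *. lra. }
  destruct (dist_to_approx (eq x) y (Rmin 1 eps)) as (_ & <- & Hlt).
  - assert (Hhalf : depth (inl x) / 2 < depth (inl y)) by nra.
    split; [|lra]. apply Rmult_lt_reg_l with (depth (inl y)); nra.
  - rewrite dist_sym. pose proof (Rmin_r 1 eps). lra.
Qed.

Definition at_infinity (p : glue) : Prop := match p with inl _ => False | inr _ => True end.

Lemma at_infinity_closed : is_closed at_infinity.
Proof.
  intros [x|z] Hp; [|now destruct Hp].
  apply (near_mono (near_inl x _ (near_ball x 1 Rlt_0_1))).
  now intros p (y & -> & _).
Qed.

Lemma at_infinity_iff (p : glue) : at_infinity p <-> Z (base p).
Proof.
  destruct p as [x|z]; split.
  - now intros [].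
  - exact (proj2_sig (f x)).
  - intros _. exact (proj2_sig z).
  - now intros _.
Qed.

Definition to_finite (x : X) : subspace glue (compl at_infinity) :=
  exist (compl at_infinity) (inl x : glue) (fun h => h).

Definition of_finite (p : subspace glue (compl at_infinity)) : X :=
  match p with
  | exist _ (inl x) _ => x
  | exist _ (inr z) h => False_rect X (h I)
  end.

Lemma to_of_finite (p : subspace glue (compl at_infinity)) : to_finite (of_finite p) = p.
Proof. apply subspace_eq. destruct p as [[x|z] h]; [reflexivity | now destruct h]. Qed.

Lemma to_finite_continuous : continuous f -> continuous to_finite.
Proof. intros Hf. exact (inl_continuous Hf). Qed.

Lemma of_finite_continuous : continuous of_finite.
Proof.
  intros p eps Heps. rewrite <- (to_of_finite p). simpl.
  apply (near_mono (continuous_near (x := to_finite (of_finite p)) (proj1_sig_continuous _)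
    (near_inl (of_finite p) _ (near_ball (of_finite p) eps Heps)))).
  intros q (y & Hy & Hclose). rewrite <- (to_of_finite q) in Hy |- *.
  injection Hy as ->. exact Hclose.
Qed.

Lemma to_finite_homeomorphism : continuous f -> homeomorphism to_finite.
Proof.
  intros Hf. exists of_finite. split; [exact (to_finite_continuous Hf)|].
  split; [exact of_finite_continuous|]. split; [reflexivity | exact to_of_finite].
Qed.

Lemma at_infinity_homeomorphic : homeomorphic (subspace glue at_infinity) (subspace Y Z).
Proof.
  set (to_Z := fun p : subspace glue at_infinity =>
    exist Z (base (proj1_sig p)) (proj1 (at_infinity_iff _) (proj2_sig p)) : subspace Y Z).
  set (of_Z := fun z : subspace Y Z => exist at_infinity (inr z : glue) I).
  exists to_Z, of_Z. split; [|split; [|split]].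
  - exact (continuous_comp (proj1_sig_continuous _) base_continuous).
  - apply (lipschitz_continuous (X := subspace Y Z) 2); [lra|]. intros z z'.
    exact (glue_dist_infinity (inr z) (inr z') (proj2_sig z)).
  - intros p. apply subspace_eq. destruct p as [[x|z] Hp]; [destruct Hp|]. simpl.
    f_equal. now apply subspace_eq.
  - intros z. now apply subspace_eq.
Qed.

Lemma glue_compact :
  compact_space Y -> continuous f ->
  (forall C, compact_set C -> compact_set (fun x => C (f x))) ->
  compact_space glue.
Proof.
  intros HY Hf f_proper I U HU Hcov.
  set (V := fun i y => near y (fun y' => forall p : glue, base p = y' -> U i p)).
  assert (HV : forall i, is_open (V i)) by (intros i; apply is_open_near).
  destruct (compact_closed_subset _ Z HY Z_closed (fun _ _ => Logic.I) I V HV) as [l Hl].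
  { intros z Hz. destruct (Hcov (inr (exist _ z Hz)) Logic.I) as [i Hi].
    destruct (HU i _ Hi) as (r & Hr & Hball). exists i.
    apply (near_mono (near_ball z (r / 2) ltac:(lra))). intros _ Hd p <-. apply Hball.
    apply Rle_lt_trans with (1 := glue_dist_infinity (inr (exist _ z Hz)) p Hz). simpl. lra. }
  set (C := fun y => ~ exists i, In i l /\ V i y).
  assert (C_compact : compact_set C).
  { apply (compact_closed_subset _ C HY); [|auto]. intros y Hy. apply NNPP in Hy.
    destruct Hy as (i & Hi & Hy). apply (near_mono (HV i y Hy)).
    intros y' Hy' HC. apply HC. eauto. }
  assert (C_avoids : forall y, C y -> compl Z y).
  { intros y HC Hz. now apply HC, Hl. }
  destruct (f_proper _ (compact_subspace (compl Z) C C_compact C_avoids) I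
    (fun i x => U i (inl x))) as [l' Hl'].
  { intros i. exact (is_open_preimage _ _ (inl_continuous Hf) (HU i)). }
  { intros x _. now apply Hcov. }
  exists (l ++ l'). intros p _. destruct (classic (C (base p))) as [Hp | Hp].
  - destruct p as [x|z]; [|exfalso; exact (C_avoids _ Hp (proj2_sig z))].
    destruct (Hl' x Hp) as (i & Hi & Hu). exists i. split; [apply in_or_app; auto | exact Hu].
  - apply NNPP in Hp. destruct Hp as (i & Hi & Hu).
    exists i. split; [apply in_or_app; auto | now apply (near_self Hu)].
Qed.

Lemma asymptotic_continuous_at_infinity {S : MetricSpace} (D : S -> Prop) (u : S -> Y)
    (g : S -> glue) (s : S) :
  continuous u -> asymptotic_on Z D u (fun s => base (g s)) -> D s -> Z (u s) ->
  forall eps, 0 < eps -> near s (fun s' => D s' -> dist (g s) (g s') < eps).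
Proof.
  intros Hu Hug Hs Hz eps Heps. destruct (Hug (eps / 4) ltac:(lra)) as (d & Hd & Hclose).
  pose proof (asymptotic_on_infinity Z D u _ s Hug Hs Hz) as Hbase. simpl in Hbase.
  apply (near_mono (near_and (continuous_near_ball s Hu Hd)
    (continuous_near_ball (eps := eps / 4) s Hu ltac:(lra)))).
  intros s' [Hd' Heps'] Hs'.
  assert (Hdepth : dist_to Z (u s') < d).
  { apply Rle_lt_trans with (2 := Hd'). rewrite dist_sym. now apply dist_to_le. }
  specialize (Hclose s' Hs' Hdepth).
  assert (Hle : dist (g s) (g s') <= 2 * dist (u s) (base (g s'))).
  { rewrite <- Hbase. apply glue_dist_infinity. now rewrite Hbase. }
  pose proof (dist_tri Y (u s) (u s') (base (g s'))). rewrite (dist_sym Y _ (u s')) in Hclose. lra.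
Qed.

Section Push.
Context (k : subspace Y (compl Z) -> X) (J : X -> R -> X) (h : Y -> R -> Y)
  (f_continuous : continuous f) (k_continuous : continuous k)
  (J_continuous : htpy_continuous J)
  (J_0 : forall x, J x 0 = k (f x)) (J_1 : forall x, J x 1 = x)
  (h_continuous : htpy_continuous h)
  (h_0 : forall y, h y 0 = y) (h_avoids : forall y t, 0 < t <= 1 -> ~ Z (h y t))
  (k_asymptotic : asymptotic_on Z (fun _ : subspace Y (compl Z) => True)
     (fun y => proj1_sig y) (fun y => proj1_sig (f (k y))))
  (J_asymptotic : asymptotic_on Z (fun p : X * R => 0 <= snd p <= 1)
     (fun p => proj1_sig (f (fst p))) (fun p => proj1_sig (f (J (fst p) (snd p))))).

Definition k_ext (y : Y) : glue :=
  match excluded_middle_informative (Z y) with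
  | left hy => inr (exist _ y hy)
  | right hy => inl (k (exist _ y hy))
  end.

Lemma k_ext_boundary (y : Y) (hy : Z y) : k_ext y = inr (exist _ y hy).
Proof.
  unfold k_ext. destruct (excluded_middle_informative (Z y)) as [hy'|]; [|contradiction].
  now rewrite (proof_irrelevance _ hy' hy).
Qed.

Lemma k_ext_interior (y : Y) (hy : compl Z y) : k_ext y = inl (k (exist _ y hy)).
Proof.
  unfold k_ext. destruct (excluded_middle_informative (Z y)) as [|hy']; [contradiction|].
  now rewrite (proof_irrelevance _ hy' hy).
Qed.

Lemma k_ext_asymptotic :
  asymptotic_on Z (fun _ : Y => True) (fun y => y) (fun y => base (k_ext y)).
Proof.
  intros eps Heps. destruct (k_asymptotic eps Heps) as (d & Hd & Hclose).
  exists d. split; [exact Hd|]. intros y _ Hy. destruct (classic (Z y)) as [hy | hy].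
  - rewrite (k_ext_boundary y hy). simpl. now rewrite dist_refl.
  - rewrite (k_ext_interior y hy). now apply (Hclose (exist _ y hy)).
Qed.

Lemma k_ext_continuous : continuous k_ext.
Proof.
  assert (Hinterior : continuous_on (compl Z) k_ext).
  { apply continuous_on_of_subspace. intros y eps Heps.
    apply (near_mono (continuous_near_ball y
      (continuous_comp k_continuous (inl_continuous f_continuous)) Heps)).
    intros y' Hy'. destruct y as [y hy], y' as [y' hy']. simpl.
    now rewrite (k_ext_interior y hy), (k_ext_interior y' hy'). }
  intros y eps Heps. destruct (classic (Z y)) as [Hy | Hy].
  - apply (near_mono (asymptotic_continuous_at_infinity _ (fun y => y) k_ext y
      (id_continuous Y) k_ext_asymptotic I Hy eps Heps)).
    auto.
  - exact (continuous_on_open_near_ball Z_closed Hinterior Hy Heps).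
Qed.

Definition retreat (p : glue) (t : R) : glue :=
  match p with
  | inl x => inl (J x (1 - t / depth p))
  | inr z => inr z
  end.

Definition invade (p : glue) (t : R) : glue := k_ext (h (base p) (t - depth p)).

(* A point retreats along [J] until the time equals its depth, when it has reached its image
   under [k f]; from then on it follows [k h f]. *)
Definition push (p : glue) (t : R) : glue :=
  if Rle_dec t (depth p) then retreat p t else invade p t.

Lemma retreat_time_bounds (x : X) (t : R) :
  0 <= t <= depth (inl x) -> 0 <= 1 - t / depth (inl x) <= 1.
Proof.
  intros Ht. pose proof (depth_inl x).
  assert (t / depth (inl x) <= 1) by (apply Rdiv_le_of_le_mul; lra).
  assert (0 <= t / depth (inl x)) by (apply Rle_div_of_mul_le; lra). lra.
Qed.

Lemma retreat_asymptotic :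
  asymptotic_on Z (fun q : prod_space glue R_line => 0 <= snd q <= depth (fst q))
    (fun q => base (fst q)) (fun q => base (retreat (fst q) (snd q))).
Proof.
  intros eps Heps. destruct (J_asymptotic eps Heps) as (d & Hd & Hclose).
  exists d. split; [exact Hd|]. intros [[x|z] t] Ht Hdepth.
  - apply (Hclose (x, _)); [apply retreat_time_bounds; exact Ht | exact Hdepth].
  - simpl. now rewrite dist_refl.
Qed.

Lemma retreat_near_finite (x : X) (t : R) (eps : R) :
  0 <= t <= depth (inl x) -> 0 < eps ->
  near ((inl x, t) : prod_space glue R_line) (fun q =>
    0 <= snd q <= depth (fst q) -> dist (retreat (inl x) t) (retreat (fst q) (snd q)) < eps).
Proof.
  intros Ht Heps. pose proof (depth_inl x) as Hpos.
  destruct (inl_continuous f_continuous (J x (1 - t / depth (inl x))) eps Heps)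
    as (e & He & Hinl).
  destruct (J_continuous x _ (retreat_time_bounds x t Ht) e He) as (d & Hd & HJ).
  assert (Hpair : continuous (fun q : prod_space glue R_line =>
      (snd q, depth (fst q)) : prod_space R_line R_line)).
  { apply (continuous_pair (X := R_line) (Y := R_line) (snd_continuous glue R_line)).
    exact depth_fst_continuous. }
  apply (near_mono (near_and
    (continuous_near (x := (inl x, t) : prod_space glue R_line) (fst_continuous glue R_line)
       (near_inl x _ (near_ball x d Hd)))
    (continuous_on_preimage Hpair Rdiv_continuous_on (inl x, t) (Rgt_not_eq _ _ Hpos) d Hd))).
  intros [p t'] [(y & Hp & Hxy) Htime] Ht'. simpl in Hp, Ht', Htime. subst p.
  apply Hinl, HJ; [now apply retreat_time_bounds | exact Hxy |].
  cbn [fst snd]. replace (1 - t / depth (inl x) - (1 - t' / depth (inl y)))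
    with (- (t / depth (inl x) - t' / depth (inl y))) by ring.
  rewrite Rabs_Ropp. apply Htime. apply Rgt_not_eq, depth_inl.
Qed.

Lemma retreat_continuous :
  continuous_on (fun q : prod_space glue R_line => 0 <= snd q <= depth (fst q))
    (fun q => retreat (fst q) (snd q)).
Proof.
  intros [[x|z] t] Ht eps Heps.
  - now apply retreat_near_finite.
  - apply (asymptotic_continuous_at_infinity _
      (fun q : prod_space glue R_line => base (fst q))
      (fun q : prod_space glue R_line => retreat (fst q) (snd q)));
      [exact base_fst_continuous | exact retreat_asymptotic | exact Ht | exact (proj2_sig z) |].
    exact Heps.
Qed.

Lemma invade_continuous :
  continuous_on (fun q : prod_space glue R_line => depth (fst q) <= snd q <= 1)
    (fun q => invade (fst q) (snd q)).
Proof.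
  apply (continuous_on_comp (E := fun _ => True)
    (f := fun q : prod_space glue R_line => h (base (fst q)) (snd q - depth (fst q))));
    [|apply continuous_continuous_on, k_ext_continuous | auto].
  apply (continuous_on_comp (Y := prod_space Y R_line)
    (f := fun q : prod_space glue R_line => (base (fst q), snd q - depth (fst q))))
    with (2 := proj1 (htpy_continuous_iff h) h_continuous).
  - apply continuous_continuous_on.
    apply (continuous_pair (Y := R_line) base_fst_continuous).
    apply (continuous_minus (fun q : prod_space glue R_line => snd q) (fun q => depth (fst q))).
    + apply snd_continuous.
    + exact depth_fst_continuous.
  - intros [p t] Ht. pose proof (depth_bounds p). simpl in *. lra.
Qed.

Lemma retreat_eq_invade (p : glue) : retreat p (depth p) = invade p (depth p).
Proof.
  unfold invade. rewrite Rminus_diag, h_0. destruct p as [x|z]; cbn [retreat base].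
  - pose proof (depth_inl x). replace (1 - depth (inl x) / depth (inl x)) with 0 by (field; lra).
    rewrite J_0. destruct (f x) as [y hy]. symmetry. apply k_ext_interior.
  - destruct z as [z hz]. symmetry. apply k_ext_boundary.
Qed.

Lemma push_continuous : htpy_continuous push.
Proof.
  apply htpy_continuous_iff.
  set (before := fun q : prod_space glue R_line => 0 <= snd q <= depth (fst q)).
  set (after := fun q : prod_space glue R_line => depth (fst q) <= snd q <= 1).
  apply (continuous_on_subset (D := fun q => before q \/ after q)).
  - apply continuous_on_union_closed.
    + apply is_closed_and; apply is_closed_le;
        auto using constant_continuous, snd_continuous, depth_fst_continuous.
    + apply is_closed_and; apply is_closed_le;
        auto using constant_continuous, snd_continuous, depth_fst_continuous.
    + apply continuous_on_eq with (2 := retreat_continuous). intros [p t] Ht. unfold push.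
      destruct (Rle_dec _ _); [reflexivity | simpl in *; lra].
    + apply continuous_on_eq with (2 := invade_continuous). intros [p t] Ht. unfold push.
      destruct (Rle_dec _ _); [|reflexivity]. simpl in *.
      replace t with (depth p) by lra. symmetry. apply retreat_eq_invade.
  - intros [p t] Ht. unfold before, after. simpl in *. lra.
Qed.

Lemma push_0 (p : glue) : push p 0 = p.
Proof.
  unfold push. pose proof (depth_bounds p). destruct (Rle_dec 0 (depth p)); [|lra].
  destruct p as [x|z]; [|reflexivity]. simpl. unfold Rdiv.
  now rewrite Rmult_0_l, Rminus_0_r, J_1.
Qed.

Lemma push_avoids_infinity (p : glue) (t : R) : 0 < t <= 1 -> ~ at_infinity (push p t).
Proof.
  intros Ht. pose proof (depth_bounds p). unfold push.
  destruct (Rle_dec t (depth p)) as [Hle | Hgt].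
  - destruct p as [x|z]; [now simpl | rewrite depth_inr in Hle; lra].
  - unfold invade. assert (hy : compl Z (h (base p) (t - depth p))) by (apply h_avoids; lra).
    now rewrite (k_ext_interior _ hy).
Qed.

Lemma at_infinity_Zset : Zset at_infinity.
Proof.
  split; [apply at_infinity_closed|]. exists push.
  split; [exact push_continuous|]. split; [exact push_0 | exact push_avoids_infinity].
Qed.
End Push.
End Glue.

(** * Group actions *)

Lemma equivariant_map_proper {G : Group} {X Y : MetricSpace} (a : G -> X -> X)
    (b : G -> Y -> Y) (f : X -> Y) (C : Y -> Prop) :
  is_action a -> cocompact_action a -> proper_action b -> continuous f -> equivariant a b f ->
  compact_set C -> compact_set (fun x => C (f x)).
Proof.
  intros (_ & _ & a_continuous) (K & HK & Hcov) Hb Hf Hequiv HC.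
  pose proof (compact_image f K (continuous_continuous_on K f Hf) HK) as HfK.
  destruct (Hb _ (compact_union _ _ HC HfK)) as [l Hl].
  apply (compact_closed_subset (fun x => exists g, In g l /\ image (a g) K x)).
  - apply (compact_list_union (fun g => image (a g) K)).
    intros g. now apply compact_image; [apply continuous_continuous_on|].
  - exact (is_open_preimage f (compl C) Hf (compact_is_closed C HC)).
  - intros x Hx. destruct (Hcov x) as (g & y & Hy & <-). exists g.
    split; [|now apply image_intro]. apply Hl. exists (f y).
    split; [right; now apply image_intro | left; now rewrite <- Hequiv].
Qed.

Section ConjugateAction.
Context {G : Group} {X Y : MetricSpace} (a : G -> X -> X) (e : X -> Y) (e' : Y -> X)
  (e_continuous : continuous e) (e'_continuous : continuous e')
  (e'_e : forall x, e' (e x) = x) (e_e' : forall y, e (e' y) = y).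

Definition conj_action (g : G) (y : Y) : Y := e (a g (e' y)).

Lemma is_action_conj : is_action a -> is_action conj_action.
Proof.
  intros (a_one & a_mul & a_continuous). unfold conj_action. split; [|split].
  - intros y. now rewrite a_one.
  - intros g g' y. now rewrite e'_e, a_mul.
  - intros g. exact (continuous_comp (continuous_comp e'_continuous (a_continuous g)) e_continuous).
Qed.

Lemma proper_action_conj : proper_action a -> proper_action conj_action.
Proof.
  intros a_proper K HK.
  destruct (a_proper _ (compact_image e' K (continuous_continuous_on K e' e'_continuous) HK))
    as [l Hl].
  exists l. intros g (y & Hy & Hgy). apply Hl. exists (e' y). split; [now apply image_intro|].
  exists (conj_action g y). split; [exact Hgy | apply e'_e].
Qed.

Lemma cocompact_action_conj : cocompact_action a -> cocompact_action conj_action.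
Proof.
  intros (K & HK & Hcov). exists (image e K).
  split; [exact (compact_image e K (continuous_continuous_on K e e_continuous) HK)|].
  intros y. destruct (Hcov (e' y)) as (g & x & Hx & Hgx).
  exists g, (e x). split; [now apply image_intro|]. unfold conj_action. now rewrite e'_e, Hgx.
Qed.

Lemma free_action_conj : free_action a -> free_action conj_action.
Proof.
  intros a_free g y Hg. apply (a_free g (e' y)). rewrite <- Hg at 2. symmetry. apply e'_e.
Qed.
End ConjugateAction.

Lemma ZStructure_of_Zcompactification {G : Group} {X Xh : MetricSpace} (Z : Xh -> Prop)
    (a : G -> X -> X) (e : X -> subspace Xh (compl Z)) (e' : subspace Xh (compl Z) -> X) :
  compact_space Xh -> Zset Z ->
  continuous e -> continuous e' -> (forall x, e' (e x) = x) -> (forall p, e (e' p) = p) ->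
  AR X -> finite_dim X ->
  is_action a -> proper_action a -> cocompact_action a -> free_action a ->
  nullity Z (conj_action a e e') -> ZStructure Xh Z (conj_action a e e').
Proof.
  intros Xh_compact HZ He He' He'e Hee' HAR [n Hdim] Hact Hproper Hcocompact Hfree Hnull.
  assert (Hhomeo : homeomorphism e) by (exists e'; auto).
  split; [split|].
  - exact (AR_of_Zset Z Xh_compact HZ (AR_homeomorphism e Hhomeo HAR)).
  - exists n. exact (dim_le_of_Zset Z n Xh_compact HZ (dim_le_homeomorphism e n Hhomeo Hdim)).
  - split; [exact Xh_compact|]. split; [apply HZ|]. split; [now apply Zset_dense_complement|].
    split; [exact HZ|]. split; [now apply is_action_conj|].
    split; [now apply proper_action_conj|]. split; [now apply cocompact_action_conj|].
    split; [now apply free_action_conj | exact Hnull].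
Qed.

(** * The nullity condition *)

Lemma nullity_of_small_translates {G : Group} {Xh : MetricSpace} (Z : Xh -> Prop)
    (a : G -> subspace Xh (compl Z) -> subspace Xh (compl Z)) :
  compact_space Xh -> Xh ->
  (forall C eps, compact_set C -> 0 < eps ->
     exists l, forall g, ~ In g l -> forall x y, C x -> C y -> dist (a g x) (a g y) < eps) ->
  nullity Z a.
Proof.
  intros Xh_compact x0 Hsmall C HC I U HU Hcov.
  destruct (lebesgue_number _ U Xh_compact) as (r & Hr & Hball).
  { intros x _. destruct (Hcov x) as [i Hi]. exists i. exact (HU i x Hi). }
  destruct (Hsmall C r HC Hr) as [l Hl]. exists l. intros g Hg.
  destruct (classic (exists x, C x)) as [[x Hx] | Hempty].
  - destruct (Hball (proj1_sig (a g x)) Logic.I) as [i Hi].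
    exists i. intros y Hy. exact (Hi _ (Hl g Hg x y Hx Hy)).
  - destruct (Hball x0 Logic.I) as [i _]. exists i. intros x Hx. destruct Hempty. eauto.
Qed.

Section Boundary.
Context {G : Group} {Y : MetricSpace} (Z : Y -> Prop)
  (b : G -> subspace Y (compl Z) -> subspace Y (compl Z))
  (Y_compact : compact_space Y) (Z_closed : is_closed Z)
  (b_action : is_action b) (b_proper : proper_action b) (b_nullity : nullity Z b).

Lemma translates_small (C : subspace Y (compl Z) -> Prop) (eps : R) :
  compact_set C -> 0 < eps ->
  exists l, forall g, ~ In g l -> forall x y, C x -> C y -> dist (b g x) (b g y) < eps.
Proof.
  intros HC Heps.
  destruct (b_nullity C HC Y (fun c y => dist c y < eps / 2)) as [l Hl].
  - intros c. apply is_open_ball.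
  - intros y. exists y. rewrite dist_refl. lra.
  - exists l. intros g Hg x y Hx Hy. destruct (Hl g Hg) as [c Hc].
    pose proof (Hc x Hx). pose proof (Hc y Hy). simpl.
    pose proof (dist_tri Y (proj1_sig (b g x)) c (proj1_sig (b g y))).
    rewrite (dist_sym Y _ c) in *. lra.
Qed.

Lemma translates_near_boundary (C : subspace Y (compl Z) -> Prop) (eps : R) :
  compact_set C -> 0 < eps ->
  exists l, forall g, ~ In g l -> forall x, C x -> dist_to Z (proj1_sig (b g x)) < eps.
Proof.
  intros HC Heps.
  assert (far_compact : compact_set
      (fun x : subspace Y (compl Z) => eps <= dist_to Z (proj1_sig x))).
  { apply (compact_subspace (compl Z) (fun y => eps <= dist_to Z y)).
    - apply (compact_closed_subset _ _ Y_compact); [|auto].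
      apply (is_closed_le (fun _ => eps) (dist_to Z)).
      + apply constant_continuous.
      + apply dist_to_continuous.
    - intros y Hy Hz. rewrite (dist_to_in Z y Hz) in Hy. lra. }
  destruct (b_proper _ (compact_union _ _ HC far_compact)) as [l Hl].
  exists l. intros g Hg x Hx. apply Rnot_le_lt. intros Hle. apply Hg, Hl. eauto.
Qed.

Lemma compact_away_from_boundary (C : subspace Y (compl Z) -> Prop) :
  compact_set C -> exists d, 0 < d /\ forall y, C y -> d <= dist_to Z (proj1_sig y).
Proof.
  intros HC. apply (compact_uniform C (fun y r => r <= dist_to Z (proj1_sig y)) HC).
  - intros; lra.
  - intros y _. pose proof (dist_to_pos Z (proj1_sig y) Z_closed (proj2_sig y)).
    exists (dist_to Z (proj1_sig y) / 2). split; [lra|].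
    apply (near_mono (near_ball y (dist_to Z (proj1_sig y) / 2) ltac:(lra))).
    intros y' Hy'. simpl in Hy'. pose proof (dist_to_le_add Z (proj1_sig y) (proj1_sig y')). lra.
Qed.

(* Near [Z] the pair [(u s, v s)] lies in a translate of one fixed compact set by an element
   outside a finite set, and such translates are small by nullity. *)
Lemma equivariant_asymptotic {S : MetricSpace} (a : G -> S -> S) (K D : S -> Prop)
    (u v : S -> subspace Y (compl Z)) :
  compact_set K -> (forall s, D s -> exists g s0, K s0 /\ a g s0 = s) ->
  continuous_on K u -> continuous_on K v ->
  (forall g s, K s -> u (a g s) = b g (u s)) -> (forall g s, K s -> v (a g s) = b g (v s)) ->
  asymptotic_on Z D (fun s => proj1_sig (u s)) (fun s => proj1_sig (v s)).
Proof.
  intros HK Hcov Hu Hv u_equiv v_equiv eps Heps.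
  pose proof (compact_image u K Hu HK) as HuK. pose proof (compact_image v K Hv HK) as HvK.
  destruct (translates_small _ eps (compact_union _ _ HvK HuK) Heps) as [l Hl].
  destruct (compact_away_from_boundary
    (fun y => exists g, In g l /\ image (b g) (image u K) y)) as (d & Hd & Haway).
  { apply (compact_list_union (fun g => image (b g) (image u K))).
    intros g. apply compact_image; [apply continuous_continuous_on, b_action | exact HuK]. }
  exists d. split; [exact Hd|]. intros s Hs Hdepth. destruct (Hcov s Hs) as (g & s0 & Hs0 & <-).
  rewrite (u_equiv g s0 Hs0) in Hdepth |- *. rewrite (v_equiv g s0 Hs0).
  apply (Hl g); [|left; now apply image_intro | right; now apply image_intro].
  intros Hg. apply (Rlt_not_le _ _ Hdepth), Haway. exists g. split; [exact Hg|].
  now do 2 apply image_intro.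
Qed.

Lemma equivariant_map_asymptotic (w : subspace Y (compl Z) -> subspace Y (compl Z)) :
  cocompact_action b -> continuous w -> equivariant b b w ->
  asymptotic_on Z (fun _ => True) (fun y => proj1_sig y) (fun y => proj1_sig (w y)).
Proof.
  intros (K & HK & Hcov) Hw w_equiv.
  apply (equivariant_asymptotic b K (fun _ => True) (fun y => y) w HK); auto.
  - apply continuous_continuous_on, id_continuous.
  - now apply continuous_continuous_on.
Qed.

Lemma equivariant_homotopy_asymptotic {X : MetricSpace} (a : G -> X -> X)
    (f : X -> subspace Y (compl Z)) (J : X -> R -> X) :
  cocompact_action a -> continuous f -> equivariant a b f -> htpy_continuous J ->
  (forall t, 0 <= t <= 1 -> equivariant a a (fun x => J x t)) ->
  asymptotic_on Z (fun p : X * R => 0 <= snd p <= 1)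
    (fun p => proj1_sig (f (fst p))) (fun p => proj1_sig (f (J (fst p) (snd p)))).
Proof.
  intros (K & HK & Hcov) Hf f_equiv HJ J_equiv.
  apply (equivariant_asymptotic (S := prod_space X R_line)
    (fun g p => (a g (fst p), snd p)) (fun p => K (fst p) /\ 0 <= snd p <= 1)
    _ (fun p => f (fst p)) (fun p => f (J (fst p) (snd p)))).
  - exact (compact_prod K _ HK (compact_segment 0 1)).
  - intros [x t] Ht. destruct (Hcov x) as (g & x0 & Hx0 & <-).
    exists g, (x0, t). split; [split; assumption | reflexivity].
  - apply continuous_continuous_on. exact (continuous_comp (fst_continuous X R_line) Hf).
  - apply (continuous_on_comp (E := fun _ => True)
      (f := fun p : prod_space X R_line => J (fst p) (snd p)) (g := f)); [| |auto].
    + apply (continuous_on_subset (proj1 (htpy_continuous_iff J) HJ)). now intros p [_ Hp].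
    + now apply continuous_continuous_on.
  - intros g p _. apply f_equiv.
  - intros g p [_ Hp]. simpl. now rewrite (J_equiv _ Hp), f_equiv.
Qed.

Lemma glue_nullity {X : MetricSpace} (a : G -> X -> X) (f : X -> subspace Y (compl Z)) :
  X -> compact_space (glue Z_closed f) -> continuous f -> equivariant a b f ->
  nullity (at_infinity Z_closed f)
    (conj_action a (to_finite Z_closed f) (of_finite Z_closed f)).
Proof.
  intros x0 glue_compact Hf Hequiv.
  apply nullity_of_small_translates; [exact glue_compact | exact (inl x0)|].
  intros C eps HC Heps.
  set (f_finite := fun p => f (of_finite Z_closed f p)).
  assert (fC_compact : compact_set (image f_finite C)).
  { apply compact_image; [|exact HC].
    apply continuous_continuous_on.
    exact (continuous_comp (of_finite_continuous Z_closed f) Hf). }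
  destruct (translates_small _ (eps / 4) fC_compact ltac:(lra)) as [l Hl].
  destruct (translates_near_boundary _ (eps / 4) fC_compact ltac:(lra)) as [l' Hl'].
  exists (l ++ l'). intros g Hg p q Hp Hq. rewrite in_app_iff in Hg.
  apply Rle_lt_trans with (1 := glue_dist_le Z_closed f _ _).
  unfold depth, conj_action. simpl. rewrite !Hequiv.
  pose proof (image_intro f_finite C p Hp) as Hfp. pose proof (image_intro f_finite C q Hq) as Hfq.
  pose proof (Hl g ltac:(auto) _ _ Hfp Hfq) as Hclose. simpl in Hclose.
  pose proof (Hl' g ltac:(auto) _ Hfp). pose proof (Hl' g ltac:(auto) _ Hfq).
  unfold f_finite in *. lra.
Qed.
End Boundary.

Theorem theorem4p1 (G : Group)
  (X1 : MetricSpace) (a1 : G -> X1 -> X1)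
  (Xh2 : MetricSpace) (Z : Xh2 -> Prop)
  (a2 : G -> subspace Xh2 (compl Z) -> subspace Xh2 (compl Z)) :
  locally_compact X1 -> AR X1 -> finite_dim X1 ->
  is_action a1 -> proper_action a1 -> cocompact_action a1 -> free_action a1 ->
  AR (subspace Xh2 (compl Z)) ->
  is_action a2 -> proper_action a2 -> cocompact_action a2 -> free_action a2 ->
  equiv_htpy_equivalent a1 a2 ->
  AR_ZStructure Xh2 Z a2 ->
  exists (Xh1 : MetricSpace) (Z1 : Xh1 -> Prop)
         (e : X1 -> subspace Xh1 (compl Z1))
         (a1' : G -> subspace Xh1 (compl Z1) -> subspace Xh1 (compl Z1)),
    homeomorphism e /\ equivariant a1 a1' e /\
    homeomorphic (subspace Xh1 Z1) (subspace Xh2 Z) /\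
    ZStructure Xh1 Z1 a1'.
Proof.
  intros _ X1_AR X1_dim a1_action a1_proper a1_cocompact a1_free _ a2_action a2_proper
    a2_cocompact _ (f & k & Hf & Hk & f_equiv & k_equiv & (J & HJ & J_0 & J_1 & J_equiv) & _)
    (_ & Xh2_compact & Z_closed & _ & (_ & h & Hh & h_0 & h_avoids) & _ & _ & _ & _ & a2_nullity).
  pose proof X1_AR as [[s _] _].
  assert (glue_is_compact : compact_space (glue Z_closed f)).
  { apply glue_compact; auto. intros C. now apply (equivariant_map_proper a1 a2). }
  assert (infinity_Zset : Zset (at_infinity Z_closed f)).
  { apply (at_infinity_Zset Z_closed f k J h); auto.
    - apply (equivariant_map_asymptotic Z a2); auto; [exact (continuous_comp Hk Hf)|].
      intros g y. now rewrite k_equiv, f_equiv.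
    - now apply (equivariant_homotopy_asymptotic Z a2 Z_closed a2_action a2_nullity a1). }
  exists (glue Z_closed f), (at_infinity Z_closed f), (to_finite Z_closed f),
    (conj_action a1 (to_finite Z_closed f) (of_finite Z_closed f)).
  split; [exact (to_finite_homeomorphism Z_closed f Hf)|].
  split; [intros g x; reflexivity|]. split; [apply at_infinity_homeomorphic|].
  apply ZStructure_of_Zcompactification; auto.
  - exact (to_finite_continuous Z_closed f Hf).
  - apply of_finite_continuous.
  - apply to_of_finite.
  - now apply (glue_nullity Z a2 Xh2_compact Z_closed a2_proper a2_nullity a1 f (s O)).
Qed.
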